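(* For any fixed $\omega\in\Omega_i'$ the following hold: (i) the curve $\eta(\cdot,\omega)$ is continuously differentiable in $(0,T)$ outside the jump times of $\omega$; (ii) if $t\in(0,T)$ is a jump time of $\omega$, then $\eta(\cdot,\omega)$ is right- and left-differentiable at $t$ with $$\lim_{s\to t^+}\dot\eta(s,\omega)=\frac{d^+}{dt}\eta(t,\omega)\quad\text{and}\quad\lim_{s\to t^-}\dot\eta(s,\omega)=\frac{d^-}{dt}\eta(t,\omega);$$ (iii) $\eta(\cdot,\omega)$ is right-differentiable at $0$ and left-differentiable at $T$ with $$\lim_{s\to 0^+}\dot\eta(s,\omega)=\frac{d^+}{dt}\eta(0,\omega)\quad\text{and}\quad\lim_{s\to T^-}\dot\eta(s,\omega)=\frac{d^-}{dt}\eta(T,\omega).$$ Here $\frac{d^+}{dt}$ and $\frac{d^-}{dt}$ denote right and left derivatives.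
   Context: $N,m\ge 1$ are integers, $\mathbb{R}_+=[0,+\infty)$. The Hamiltonians $H_1,\dots,H_m:\mathbb{R}^N\times\mathbb{R}^N\to\mathbb{R}$ satisfy: each $H_i$ is uniformly continuous on $\mathbb{R}^N\times B_R$ for every $R>0$ ($B_R$ the open ball of radius $R$ centred at $0$); there are superlinear functions $\alpha,\beta:\mathbb{R}_+\to\mathbb{R}$ (i.e. $\alpha(h)/h\to+\infty$, $\beta(h)/h\to+\infty$ as $h\to+\infty$) with $\alpha(|p|)\le H_i(x,p)\le\beta(|p|)$ for all $(x,p)$; $p\mapsto H_i(x,p)$ is strictly convex for every $x$; $H_i\in C^1(\mathbb{R}^N\times\mathbb{R}^N)$. The Lagrangians are $L_i(x,q)=\sup_{p}\{\langle p,q\rangle-H_i(x,p)\}$. $B=(b_{ij})$ is a real $m\times m$ matrix with $b_{ij}\le 0$ for $j\ne i$ and $\sum_{j}b_{ij}=0$ for every $i$; $(B\mathbf{u})_i=\sum_jb_{ij}u_j$. Random frame: $\Omega$ is the space of right-continuous paths $\omega:\mathbb{R}_+\to\{1,\dots,m\}$ with left limits; the jump times of $\omega$ are its discontinuity points. $\mathcal{F}$ is the $\sigma$-algebra generated by the evaluation maps $\omega\mapsto\omega(t)$, $t\ge0$. $\Omega_i=\{\omega:\omega(0)=i\}$. $\mathbb{P}$ is a probability measure on $(\Omega,\mathcal{F})$ under which $(\omega(t))_{t\ge0}$ is a Markov chain with generator matrix $-B$ (transition matrices $e^{-Bt}$), with $\mathbb{P}(\Omega_i)>0$ for each $i$;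 $\mathbb{P}_i$ is $\mathbb{P}$ conditioned to $\Omega_i$ and $\mathbb{E}_i$ the corresponding expectation. Admissible curve (on $[0,T]$, starting at $x$): a random variable $\eta:\Omega\to C([0,T];\mathbb{R}^N)$, written $\eta(t,\omega)$, with $\eta(0,\omega)=x$ for all $\omega$, such that for every $\varepsilon>0$ there is $\delta>0$ such that $\sum_j(b_j-a_j)<\delta$ implies $\sum_j|\eta(b_j,\omega)-\eta(a_j,\omega)|<\varepsilon$ for any finite family of pairwise disjoint intervals $(a_j,b_j)\subset[0,T]$ and any $\omega\in\Omega$; and such that $\omega_1\equiv\omega_2$ in $[0,t]$ implies $\eta(\cdot,\omega_1)\equiv\eta(\cdot,\omega_2)$ in $[0,t]$, for any $t\in[0,T]$. Setting: $\mathbf{u}^0:\mathbb{R}^N\to\mathbb{R}^m$ is bounded and Lipschitz continuous, and $\mathbf{u}$ is the unique viscosity solution of $\partial_tu_i+H_i(x,D_xu_i)+(B\mathbf{u}(t,x))_i=0$ in $(0,+\infty)\times\mathbb{R}^N$, $i\in\{1,\dots,m\}$, with $\mathbf{u}(0,\cdot)=\mathbf{u}^0$, that is bounded and uniformly continuous on $[0,T]\times\mathbb{R}^N$ for every $T>0$ (it is then Lipschitz continuous on each $[0,T]\times\mathbb{R}^N$). $T>0$, $x\in\mathbb{R}^N$, $i\in\{1,\dots,m\}$ are fixed, and $\eta:\Omega\to C([0,T];\mathbb{R}^N)$ is an admissible curve starting at $x$ which minimizes the Lax–Oleinik functional, i.e. $$u_i(T,x)=\mathbb{E}_i\Big[u^0_{\omega(T)}(\eta(T,\omega))+\int_0^TL_{\omega(s)}(\eta(s,\omega),-\dot\eta(s,\omega))\,ds\Big],$$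 and this equals the infimum of the same functional over all admissible curves starting at $x$. Set $L_{G_j}(t,x,q)=L_j(x,q)-(B\mathbf{u}(t,x))_j$. $\Omega_i'\subset\Omega_i$ is a fixed set of full $\mathbb{P}_i$-measure such that for all $\omega\in\Omega_i'$, whenever $0\le a<b\le T$ and $\omega$ is constantly equal to some $j$ on $[a,b)$, $$u_j(T-a,\eta(a,\omega))-u_j(T-b,\eta(b,\omega))=\int_a^bL_{G_j}(T-s,\eta(s,\omega),-\dot\eta(s,\omega))\,ds$$ (such a set exists). *)

(* Defs.v *)
From HB Require Import structures.
From mathcomp Require Import all_boot all_order all_algebra.
From mathcomp Require Import all_classical all_reals all_analysis.

Set Implicit Arguments.
Unset Strict Implicit.
Unset Printing Implicit Defensive.

Import Order.TTheory GRing.Theory Num.Theory.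
Import numFieldNormedType.Exports.

Local Open Scope classical_set_scope.
Local Open Scope ring_scope.

(* R^N is 'rV[R]_N. The library norm on 'rV[R]_N is the max norm: it is used
   only where the choice among equivalent norms is immaterial (topology,
   boundedness, Lipschitz and uniform continuity); |.| is [enorm]. *)

Definition dotv (R : realType) (N : nat) (p q : 'rV[R]_N) : R :=
  \sum_(k < N) p ord0 k * q ord0 k.

Definition enorm (R : realType) (N : nat) (p : 'rV[R]_N) : R :=
  Num.sqrt (dotv p p).

Definition unif_continuous_on (R : realType) (V W : normedModType R)
    (A : set V) (f : V -> W) : Prop :=
  forall e : R, 0 < e -> exists2 d : R, 0 < d &
    forall y z, A y -> A z -> `|y - z| < d -> `|f y - f z| < e.

(* For V of finite dimension, continuity of y |-> 'd f y v for every v is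
   continuity of the differential. *)
Definition C1_on (R : realType) (V : normedModType R) (A : set V)
    (f : V -> R) : Prop :=
  forall z, A z -> differentiable f z /\
    forall v : V, {for z, continuous (fun y => 'd f y v)}.

(* Functions on [0, +oo) are functions on R whose values on negative reals
   are never used. *)
Definition superlinear (R : realType) (a : R -> R) : Prop :=
  a h / h @[h --> +oo] --> +oo.

Definition strictly_convex (R : realType) (V : lmodType R) (f : V -> R) :
    Prop :=
  forall (p q : V) (l : R), p != q -> 0 < l -> l < 1 ->
    f (l *: p + (1 - l) *: q) < l * f p + (1 - l) * f q.

Definition hamiltonians (R : realType) (N m : nat)
    (H : 'I_m -> 'rV[R]_N -> 'rV[R]_N -> R) : Prop :=
  [/\ forall i (r : R), 0 < r ->
        unif_continuous_on [set z : 'rV[R]_N * 'rV[R]_N | enorm z.2 < r]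
          (fun z => H i z.1 z.2),
      exists a b : R -> R, [/\ superlinear a, superlinear b &
        forall i x p, a (enorm p) <= H i x p <= b (enorm p)],
      forall i x, strictly_convex (H i x) &
      forall i, C1_on setT (fun z : 'rV[R]_N * 'rV[R]_N => H i z.1 z.2)].

Definition lagrangian (R : realType) (N m : nat)
    (H : 'I_m -> 'rV[R]_N -> 'rV[R]_N -> R) (i : 'I_m) (x q : 'rV[R]_N) : R :=
  sup (range (fun p => dotv p q - H i x p)).

Definition coupling_matrix (R : realType) (m : nat) (B : 'M[R]_m) : Prop :=
  (forall i j, j != i -> B i j <= 0) /\ (forall i, \sum_(j < m) B i j = 0).

Definition time_deriv (R : realType) (N : nat) (phi : R * 'rV[R]_N -> R)
    (z : R * 'rV[R]_N) : R :=
  'D_(1, 0) phi z.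

Definition space_grad (R : realType) (N : nat) (phi : R * 'rV[R]_N -> R)
    (z : R * 'rV[R]_N) : 'rV[R]_N :=
  \row_k 'D_(0, delta_mx 0 k) phi z.

(* phi touches u_i locally from above, resp. from below, up to a constant. *)
Definition viscosity_subsolution (R : realType) (N m : nat)
    (H : 'I_m -> 'rV[R]_N -> 'rV[R]_N -> R) (B : 'M[R]_m)
    (u : R -> 'rV[R]_N -> 'cV[R]_m) : Prop :=
  forall (i : 'I_m) (phi : R * 'rV[R]_N -> R) (t : R) (x : 'rV[R]_N),
    C1_on [set z : R * 'rV[R]_N | 0 < z.1] phi -> 0 < t ->
    (\forall z \near (t, x),
      u z.1 z.2 i ord0 - phi z <= u t x i ord0 - phi (t, x)) ->
    time_deriv phi (t, x) + H i x (space_grad phi (t, x))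
      + (B *m u t x) i ord0 <= 0.

Definition viscosity_supersolution (R : realType) (N m : nat)
    (H : 'I_m -> 'rV[R]_N -> 'rV[R]_N -> R) (B : 'M[R]_m)
    (u : R -> 'rV[R]_N -> 'cV[R]_m) : Prop :=
  forall (i : 'I_m) (phi : R * 'rV[R]_N -> R) (t : R) (x : 'rV[R]_N),
    C1_on [set z : R * 'rV[R]_N | 0 < z.1] phi -> 0 < t ->
    (\forall z \near (t, x),
      u t x i ord0 - phi (t, x) <= u z.1 z.2 i ord0 - phi z) ->
    0 <= time_deriv phi (t, x) + H i x (space_grad phi (t, x))
      + (B *m u t x) i ord0.

Definition viscosity_solution (R : realType) (N m : nat)
    (H : 'I_m -> 'rV[R]_N -> 'rV[R]_N -> R) (B : 'M[R]_m)
    (u : R -> 'rV[R]_N -> 'cV[R]_m) : Prop :=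
  viscosity_subsolution H B u /\ viscosity_supersolution H B u.

Definition slab (R : realType) (N : nat) (T : R) : set (R * 'rV[R]_N) :=
  [set z | 0 <= z.1 <= T].

(* The space Omega. A path on [0, +oo) is encoded as a function on R, extended
   to the negative reals by its value at 0, so that equality of records is
   equality of paths. *)
Record cadlag (R : realType) (m : nat) := Cadlag {
  path_fun :> R -> 'I_m.+1 ;
  path_neg : forall t, t < 0 -> path_fun t = path_fun 0 ;
  path_right_cont : forall t, 0 <= t ->
    \forall s \near t^'+, path_fun s = path_fun t ;
  path_left_lim : forall t, 0 < t ->
    exists j, \forall s \near t^'-, path_fun s = j }.

Definition cadlag_cst (R : realType) (m : nat) : cadlag R m.
Proof.
apply: (@Cadlag R m (fun=> ord0)) => //.
- by move=> t _; exact: nearW.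
- by move=> t _; exists ord0; exact: nearW.
Defined.

HB.instance Definition _ (R : realType) (m : nat) :=
  gen_eqMixin (cadlag R m).
HB.instance Definition _ (R : realType) (m : nat) :=
  gen_choiceMixin (cadlag R m).
HB.instance Definition _ (R : realType) (m : nat) :=
  isPointed.Build (cadlag R m) (cadlag_cst R m).

Definition evaluation_events (R : realType) (m : nat) :
    set (set (cadlag R m)) :=
  [set A | exists t (S : set 'I_m.+1),
    0 <= t /\ A = [set w : cadlag R m | S (w t)]].

Fact cadlag_display : measure_display. Proof. exact: default_measure_display. Qed.

HB.instance Definition _ (R : realType) (m : nat) :=
  @isMeasurable.Build cadlag_display (cadlag R m)
    <<s @evaluation_events R m >>
    (@sigma_algebra0 _ setT _) (@sigma_algebraC _ _)
    (@sigma_algebra_bigcup _ setT _).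

(* The discontinuity points for the discrete topology on the states; by
   right-continuity and the encoding above, 0 is never one. *)
Definition jump_time (R : realType) (m : nat) (w : cadlag R m) (t : R) : Prop :=
  ~ \forall s \near t, w s = w t.

Definition start_at (R : realType) (m : nat) (i : 'I_m.+1) : set (cadlag R m) :=
  [set w | w 0 = i].

Lemma measurable_start_at (R : realType) (m : nat) (i : 'I_m.+1) :
  measurable (@start_at R m i).
Proof. by apply: sub_sigma_algebra; exists 0, [set i]. Qed.

(* [mnormalize mu P] is mu normalized to mass 1, its second argument being
   relevant only if mu is null or infinite. *)
Definition cond_start (R : realType) (m : nat)
    (P : probability (cadlag R m) R) (i : 'I_m.+1) :
    probability (cadlag R m) R :=
  mnormalize (mrestr P (@measurable_start_at R m i)) P.

Definition expmx (R : realType) (n : nat) (A : 'M[R]_n.+1) : 'M[R]_n.+1 :=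
  limn (series (fun k => (k`!%:R : R)^-1 *: A ^+ k)).

(* Product form of P(w(t_(n+1)) = j_(n+1) | w(t_0) = j_0, .., w(t_n) = j_n) =
   e^(-(t_(n+1) - t_n) B)_(j_n, j_(n+1)), which also covers null
   conditioning events. *)
Definition markov_chain (R : realType) (m : nat) (B : 'M[R]_m.+1)
    (P : probability (cadlag R m) R) : Prop :=
  forall (n : nat) (t : nat -> R) (j : nat -> 'I_m.+1),
    0 <= t 0%N -> (forall k, t k < t k.+1) ->
    P [set w | forall k, (k <= n.+1)%N -> w (t k) = j k] =
    (P [set w | forall k, (k <= n)%N -> w (t k) = j k] *
      (expmx (- (t n.+1 - t n) *: B) (j n) (j n.+1))%:E)%E.

(* An element of C([0, T]; R^N) is represented by a function on R, of which
   only the restriction to [0, T] matters. Borel measurability for the uniform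
   topology is required on open sets, a generating family. *)
Definition random_curve (R : realType) (N m : nat) (T : R)
    (eta : cadlag R m -> R -> 'rV[R]_N) : Prop :=
  (forall w, {within `[0, T], continuous (eta w)}) /\
  (forall A : set {uniform` `[0, T] -> 'rV[R]_N}, open A ->
    measurable [set w | A (eta w)]).

Definition admissible_curve (R : realType) (N m : nat) (T : R) (x : 'rV[R]_N)
    (eta : cadlag R m -> R -> 'rV[R]_N) : Prop :=
  [/\ random_curve T eta,
      forall w, eta w 0 = x,
      forall e : R, 0 < e -> exists2 d : R, 0 < d &
        forall (n : nat) (a b : 'I_n -> R) (w : cadlag R m),
          (forall k, 0 <= a k /\ a k < b k /\ b k <= T) ->
          trivIset setT (fun k => `]a k, b k[%classic) ->
          \sum_(k < n) (b k - a k) < d ->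
          \sum_(k < n) enorm (eta w (b k) - eta w (a k)) < e &
      forall t, 0 <= t <= T -> forall w1 w2 : cadlag R m,
        (forall s, 0 <= s <= t -> w1 s = w2 s) ->
        forall s, 0 <= s <= t -> eta w1 s = eta w2 s].

(* [derive1 (eta w) s] is the derivative at the points of differentiability, hence
   for almost every s in [0, T] if eta is admissible. The integrals are taken
   in \bar R, as the inner one may be +oo for some admissible curves. *)
Definition lax_oleinik (R : realType) (N m : nat)
    (H : 'I_m.+1 -> 'rV[R]_N -> 'rV[R]_N -> R) (P : probability (cadlag R m) R)
    (u0 : 'rV[R]_N -> 'cV[R]_m.+1) (T : R) (i : 'I_m.+1)
    (eta : cadlag R m -> R -> 'rV[R]_N) : \bar R :=
  (\int[cond_start P i]_w
    ((u0 (eta w T) (w T) ord0)%:E +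
     \int[lebesgue_measure]_(s in `[0%R, T])
       (lagrangian H (w s) (eta w s) (- derive1 (eta w) s))%:E))%E.

(* The Lagrangian L_{G_j}(t, x, q). *)
Definition lagrangianG (R : realType) (N m : nat)
    (H : 'I_m -> 'rV[R]_N -> 'rV[R]_N -> R) (B : 'M[R]_m)
    (u : R -> 'rV[R]_N -> 'cV[R]_m) (j : 'I_m) (t : R) (x q : 'rV[R]_N) : R :=
  lagrangian H j x q - (B *m u t x) j ord0.

Definition is_right_deriv (R : realType) (V : normedModType R) (f : R -> V)
    (t : R) (l : V) : Prop :=
  h^-1 *: (f (t + h) - f t) @[h --> 0^'+] --> l.

Definition is_left_deriv (R : realType) (V : normedModType R) (f : R -> V)
    (t : R) (l : V) : Prop :=
  h^-1 *: (f (t + h) - f t) @[h --> 0^'-] --> l.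

(* Main.v *)
(* On an interval where [w] is constantly [j], write [c r] for the curve [eta w] run
   backwards in time, [U r z] for [u_j] and [b] for [(B u)_j].
   Since [L_j x q >= <p, q> - H_j x p], the calibration identity bounds [U t (c t) - U s (c s)]
   from below by [<p, c t - c s>] minus the integral of [H_j (c r) p + b r (c r)]; here an
   absolutely continuous curve must be the integral of its almost everywhere derivative
   (Jordan decomposition, Stieltjes measures, Radon-Nikodym and Lebesgue differentiation).
   Taking [p] large makes [c] Lipschitz. In the other direction, the subsolution property
   bounds the growth of [U] along a segment of slope [q] issued from [y] at time [s] by
   [(t - s) (L_j y q - b s y + C (t - s))].
   Now divide a short time window into equal pieces, replace the slopes [q] and [q'] of two
   of them by their mean and translate the curve in between. Comparing both bounds gives
   [L_j x q + L_j x q' - 2 L_j x ((q + q') / 2) <= C * (length of the window)], uniformly in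
   the size of the pieces. As [H_j] is C^1, [L_j x] is uniformly convex, so all the
   difference quotients in a short window are close to each other, up to the end points of
   the interval: the curve is C^1 there, with one-sided derivatives at the end points that
   are limits of its derivative. *)
From HB Require Import structures.
Require Import Defs.
From mathcomp Require Import all_boot all_order all_algebra.
From mathcomp Require Import all_classical all_reals all_analysis.
From mathcomp Require Import measurable_realfun ring lra.

Import Order.TTheory GRing.Theory Num.Theory.
Import numFieldNormedType.Exports.

Local Open Scope classical_set_scope.
Local Open Scope ring_scope.

Set Implicit Arguments.
Unset Strict Implicit.
Unset Printing Implicit Defensive.

(** The coupling term [(B u)_j] is only Lipschitz, so no Euler-Lagrange equation is available along
    the curve, and [U] itself need not be differentiable there. Regularity has to come from
    comparing finite costs, and what makes this possible is a balance of orders. With pieces of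
    length [eps], averaging two slopes saves [eps] times a second difference of [L_j x]. Keeping the
    end points fixed takes a translation of size [O(eps)], which costs [O(eps)] per unit of time,
    hence [eps] times the length of the window in total. The factor [eps] cancels, so the estimate
    survives arbitrarily fine subdivisions. Time is reversed because [u] evolves forward from its
    initial datum while [eta] starts at the final time: along [c] the value grows by the cost, and
    slopes enter [L_j] with a plus sign. The integrand of the calibration identity is not known to
    be measurable. It is therefore only bounded from below, with a constant [p], so that the sole
    integral to compute is that of the velocity. *)

(** * Absolutely continuous functions *)

(* Finite families of disjoint intervals are lists of pairs ordered from left to right. *)
Definition seg_next (R : realType) (x y : R * R) : bool :=
  (x.2 <= y.1) && (y.1 < y.2).

(* The degenerate initial interval [(a, a)] makes the path start to the right of [a]. *)
Definition segs (R : realType) (a b : R) (l : seq (R * R)) : Prop :=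
  path (@seg_next R) (a, a) l /\ (last (a, a) l).2 <= b.

Definition seg_ac (R : realType) (T : R) (F : R * R -> R) : Prop :=
  forall e, 0 < e -> exists2 d, 0 < d & forall l, segs 0 T l ->
    \sum_(x <- l) (x.2 - x.1) < d -> \sum_(x <- l) F x <= e.

(** Bridge from [itv_partition], in terms of which variations are defined, to ordered lists of
    segments. *)
Lemma segs_partition (R : realType) (f : R -> R) (s : seq R) (a b : R) :
  itv_partition a b s ->
  let l := zip (a :: s) s in
  [/\ path (@seg_next R) (a, a) l, (last (a, a) l).2 = b,
    \sum_(x <- l) (x.2 - x.1) = b - a &
    \sum_(x <- l) `|f x.2 - f x.1| = variation a b f s].
Proof.
move=> abs l.
have [-> -> ->] : [/\ path (@seg_next R) (a, a) l, (last (a, a) l).2 = b &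
    \sum_(x <- l) (x.2 - x.1) = b - a].
  rewrite {}/l; elim: s a abs => [a /itv_partition_nil -> /=|h t ih a].
    by rewrite big_nil subrr.
  move=> abs; have {ih}[/= p1 p2 p3] := ih h (itv_partition_cons abs).
  case: abs => /= /andP[ah _] _; split.
  - rewrite /seg_next/= lexx ah/=.
    by move: p1; case: (t) => //.
  - by move: p2; case: (t) => //= y t' <-.
  - by rewrite big_cons /= p3; ring.
split => //; rewrite (variation_zip _ abs) /l.
elim: s a {abs l} => [|h t ih] a; first by rewrite !big_nil.
by rewrite /= !big_cons /= ih.
Qed.

Lemma seg_path_start (R : realType) (x y : R * R) l : x.2 = y.2 ->
  path (@seg_next R) x l = path (@seg_next R) y l.
Proof. by move=> xy; case: l => //= z l; rewrite /seg_next xy. Qed.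

Lemma seg_last_start (R : realType) (x y : R * R) (l : seq (R * R)) : x.2 = y.2 ->
  (last x l).2 = (last y l).2.
Proof. by case: l. Qed.

Lemma seg_last_ge (R : realType) (a : R * R) (l : seq (R * R)) :
  path (@seg_next R) a l -> a.2 <= (last a l).2.
Proof.
elim: l a => //= x l ih a /andP[/andP[ax xx] /ih]; apply: le_trans.
exact: le_trans ax (ltW xx).
Qed.

(** Each total variation is a supremum over partitions. Replacing a segment by a nearly optimal
    partition keeps the total length, hence the smallness required by absolute continuity; the
    tolerance is halved at each step of the induction. *)
Lemma segs_refine (R : realType) (f : R -> R) (b : R) (l : seq (R * R)) (a e : R) :
  (forall x y, a <= x -> x <= y -> y <= b -> bounded_variation x y f) ->
  segs a b l -> 0 < e ->
  exists2 l', segs a b l' &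
    \sum_(x <- l') (x.2 - x.1) = \sum_(x <- l) (x.2 - x.1) /\
    \sum_(x <- l) fine (total_variation x.1 x.2 f) - e <=
      \sum_(x <- l') `|f x.2 - f x.1|.
Proof.
elim: l a e => [|[x y] l ih] a e bv.
  move=> ab e0; exists [::] => //; rewrite !big_nil sub0r oppr_le0.
  by split=> //; exact: ltW.
move=> [/= /andP[/andP[/= ax xy] pl] lb] e0.
have yb : y <= b by rewrite (le_trans _ lb)// (@seg_last_ge _ (x, y)).
have ay : a <= y by rewrite (le_trans ax)// ltW.
have [|||l' [pl' ll'] [l'1 l'2]] := ih y (e / 2).
- by move=> u v yu; apply: bv; rewrite (le_trans ay).
- split; last by rewrite (@seg_last_start _ _ (x, y)).
  by rewrite (@seg_path_start _ _ (x, y)).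
- by rewrite divr_gt0.
have bvxy : bounded_variation x y f by apply: bv => //; exact: ltW.
have e20 : 0 < e / 2 by rewrite divr_gt0.
have fTV := bvxy; move/(bounded_variationP _ (ltW xy)) : fTV => fTV.
have [_ [_ [s xys <-] <-] sTV] := ub_ereal_sup_adherent e20 fTV.
have [p1 p2 p3 p4] := segs_partition f xys.
exists (zip (x :: s) s ++ l').
  split.
    rewrite cat_path; apply/andP; split.
      (* The list of pieces is not empty: its total length would be [0] instead of [y - x]. *)
      move: p1; case: (zip _ _) (p3) => [|z t] /=.
        by rewrite big_nil => /eqP; rewrite eq_sym subr_eq0 => /eqP yx; rewrite yx ltxx in xy.
      move=> _ /andP[/andP[/= xz zz] ->]; rewrite andbT /seg_next/= zz andbT.
      exact: le_trans ax xz.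
    rewrite (@seg_path_start _ _ (y, y))// -p2/= .
    case: (zip _ _) (p3) => //; rewrite big_nil => /eqP; rewrite eq_sym subr_eq0.
    by move=> /eqP yx; rewrite yx ltxx in xy.
  rewrite last_cat (@seg_last_start _ _ (y, y))//=.
  rewrite -p2/=.
  case: (zip _ _) (p3) => //; rewrite big_nil => /eqP; rewrite eq_sym subr_eq0.
  by move=> /eqP yx; rewrite yx ltxx in xy.
rewrite !big_cat !big_cons /= p3 l'1; split => //.
rewrite p4.
have : fine (total_variation x y f) - e / 2 <= variation x y f s.
  by rewrite -lee_fin EFinB fineK// ltW.
move: l'2; set A := \sum_(_ <- _) _; set B := \sum_(_ <- _) _.
by set C := fine _; set D := variation _ _ _ _; lra.
Qed.

Lemma seg_path_le (R : realType) (x y : R * R) l : x.2 <= y.2 ->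
  path (@seg_next R) y l -> path (@seg_next R) x l.
Proof.
move=> xy; case: l => //= z l /andP[/andP[yz zz] ->].
by rewrite /seg_next zz (le_trans xy).
Qed.

(** On an interval shorter than the [d] associated with [e = 1] the variation is at most [1], and
    finitely many such intervals cover [[0, T]]. *)
Lemma seg_ac_bounded_variation (R : realType) (T : R) (f : R -> R) : 0 < T ->
  seg_ac T (fun x => `|f x.2 - f x.1|) ->
  forall x y, 0 <= x -> x <= y -> y <= T -> bounded_variation x y f.
Proof.
move=> T0 acf.
suff bvT : bounded_variation 0 T f.
  move=> x y x0 xy yT; apply: (@bounded_variationl _ _ _ T) => //.
  by apply: (@bounded_variationr _ 0) => //; exact: le_trans yT.
have [d d0 fd] := acf 1 ltr01.
have small x y : 0 <= x -> x <= y -> y <= T -> y - x < d ->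
    bounded_variation x y f.
  move=> x0 xy yT yxd; exists 1 => _ [s xys <-].
  have [p1 p2 p3 p4] := segs_partition f xys.
  rewrite -p4; apply: fd; last by rewrite p3.
  split; first exact: seg_path_le p1.
  by move: p2; case: (zip _ _) => [_|z l /= ->] //=; exact: ltW.
pose n := (Num.truncn (T / d)).+1; pose h := T / n%:R.
have n0 : 0 < n%:R :> R by rewrite ltr0n.
have h0 : 0 <= h by rewrite /h divr_ge0// ltW.
have hd : h < d.
  rewrite /h ltr_pdivrMr// mulrC -ltr_pdivrMr//.
  by rewrite truncnS_gt.
have hn : h * n%:R = T by rewrite /h divfK// gt_eqF.
suff bvk k : (k <= n)%N -> bounded_variation 0 (h * k%:R) f.
  by rewrite -hn; exact: bvk.
elim: k => [|k ih] kn; first by rewrite mulr0; exact: bounded_variationxx.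
have hk0 : 0 <= h * k%:R by rewrite mulr_ge0.
have hkS : h * k%:R <= h * k.+1%:R by rewrite ler_wpM2l// ler_nat.
have hkT : h * k.+1%:R <= T by rewrite -hn ler_wpM2l// ler_nat.
apply/bounded_variationP; first exact: le_trans hkS.
rewrite (total_variationD f hk0 hkS) fin_numD; apply/andP; split.
  by apply/bounded_variationP => //; apply: ih; exact: ltnW.
apply/bounded_variationP => //; apply: small => //.
by rewrite -mulrBr -natrB// subSnn mulr1.
Qed.

Lemma seg_ac_total_variation (R : realType) (T : R) (f : R -> R) : 0 < T ->
  seg_ac T (fun x => `|f x.2 - f x.1|) ->
  seg_ac T (fun x => fine (total_variation x.1 x.2 f)).
Proof.
move=> T0 acf e e0; have e20 : 0 < e / 2 by rewrite divr_gt0.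
have [d d0 fd] := acf _ e20; exists d => // l sl ld.
have [l' sl' [l'1 l'2]] :=
  segs_refine (seg_ac_bounded_variation T0 acf) sl e20.
by have := fd _ sl'; rewrite l'1 => /(_ ld); lra.
Qed.

Lemma fine_total_variationB (R : realType) (T : R) (f : R -> R) (x y : R) :
  (forall x y, 0 <= x -> x <= y -> y <= T -> bounded_variation x y f) ->
  0 <= x -> x <= y -> y <= T ->
  fine (total_variation 0 y f) - fine (total_variation 0 x f) =
  fine (total_variation x y f).
Proof.
move=> bv x0 xy yT.
rewrite (total_variationD f x0 xy) fineD.
- by rewrite addrAC subrr add0r.
- by apply/bounded_variationP => //; apply: bv => //; exact: le_trans yT.
- by apply/bounded_variationP => //; apply: bv.
Qed.

Lemma seg_bounds (R : realType) (a b : R) (l : seq (R * R)) : segs a b l ->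
  forall x, x \in l -> [/\ a <= x.1, x.1 < x.2 & x.2 <= b].
Proof.
elim: l a => // y l ih a [/= /andP[/andP[/= ay yy] pl] lb] x.
have y2 : y.2 <= (last y l).2 by exact: seg_last_ge.
rewrite inE => /predU1P[->|xl]; first by split => //; exact: le_trans lb.
have [|yx xx xb] := ih y.2 _ _ xl.
  split; last by rewrite (@seg_last_start _ _ y).
  by rewrite (@seg_path_start _ _ y).
by split => //; rewrite (le_trans _ yx)// (le_trans ay)// ltW.
Qed.

(** Jordan decomposition [f = (v + f) - v] with [v] the total variation from [0]: the increments of
    [v] dominate those of [f] in absolute value, and [v] inherits absolute continuity. *)
Lemma seg_ac_decomposition (R : realType) (T : R) (f : R -> R) : 0 < T ->
  seg_ac T (fun x => `|f x.2 - f x.1|) ->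
  exists2 v : R -> R,
    (forall x y, 0 <= x -> x <= y -> y <= T -> v x <= v y) /\
    seg_ac T (fun x => v x.2 - v x.1) &
    (forall x y, 0 <= x -> x <= y -> y <= T -> v x + f x <= v y + f y) /\
    seg_ac T (fun x => (v x.2 + f x.2) - (v x.1 + f x.1)).
Proof.
move=> T0 acf; have bv := seg_ac_bounded_variation T0 acf.
pose v x := fine (total_variation 0 x f).
have vB x y : 0 <= x -> x <= y -> y <= T ->
    v y - v x = fine (total_variation x y f).
  by move=> *; exact: (@fine_total_variationB _ T).
have acv := seg_ac_total_variation T0 acf.
have fv x y : 0 <= x -> x <= y -> y <= T -> `|f y - f x| <= v y - v x.
  move=> x0 xy yT; rewrite vB// -lee_fin fineK; first exact: total_variation_ge.
  by apply/bounded_variationP => //; exact: bv.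
exists v; split.
- move=> x y x0 xy yT; rewrite -subr_ge0; exact: le_trans (fv _ _ x0 xy yT).
- move=> e e0; have [d d0 vd] := acv e e0; exists d => // l sl ld.
  rewrite big_seq (eq_bigr (fun x => fine (total_variation x.1 x.2 f))) -?big_seq.
    exact: vd.
  move=> x xl; have [x0 xx xT] := seg_bounds sl xl.
  by rewrite vB// ltW.
- move=> x y x0 xy yT; have := fv _ _ x0 xy yT.
  by have := ler_norm (- (f y - f x)); rewrite normrN; lra.
- move=> e e0; have e20 : 0 < e / 2 by rewrite divr_gt0.
  have [d1 d10 vd1] := acv _ e20; have [d2 d20 vd2] := acf _ e20.
  exists (Num.min d1 d2); first by rewrite lt_min d10 d20.
  move=> l sl; rewrite lt_min => /andP[ld1 ld2].
  have := vd1 _ sl ld1; have := vd2 _ sl ld2.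
  suff : \sum_(x <- l) (v x.2 + f x.2 - (v x.1 + f x.1)) <=
      \sum_(x <- l) `|f x.2 - f x.1| +
      \sum_(x <- l) fine (total_variation x.1 x.2 f) by lra.
  rewrite -big_split/= big_seq [leRHS]big_seq; apply: ler_sum => x xl.
  have [x0 xx xT] := seg_bounds sl xl.
  by rewrite -vB// ?(ltW xx)//; have := ler_norm (f x.2 - f x.1); lra.
Qed.

Lemma segs_grid (R : realType) (h : R) (P : pred nat) (n m : nat) (x : R * R) :
  0 < h -> x.2 <= h * m%:R ->
  let l := [seq (h * k%:R, h * k.+1%:R) | k <- iota m n & P k] in
  path (@seg_next R) x l /\ (last x l).2 <= h * (m + n)%:R.
Proof.
move=> h0; elim: n m x => [|n ih] m x xm /=; first by rewrite addn0.
have hS : h * m%:R < h * m.+1%:R by rewrite ltr_pM2l// ltr_nat.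
case: ifPn => _; rewrite /= -addSnnS.
  have [p1 p2] := ih m.+1 (h * m%:R, h * m.+1%:R) (lexx _).
  by rewrite /seg_next xm hS p1.
by apply: ih; exact: le_trans (ltW hS).
Qed.

(** * Dyadic exhaustion of open sets *)

Section dyadic_cells.
Context {R : realType} (T : R) (T0 : 0 < T) (U : set R).

Definition dyadic_step n : R := T / (2 ^ n)%:R.

Definition dyadic_cell n (k : nat) : set R :=
  `]dyadic_step n * k%:R, dyadic_step n * k.+1%:R]%classic.

(* Exhausts [U `&` `]0, T]] by finite disjoint unions of intervals, to which absolute
   continuity applies. *)
Definition dyadic_inner n : set R :=
  \big[setU/set0]_(k < 2 ^ n | `[< dyadic_cell n k `<=` U >]) dyadic_cell n k.

Lemma dyadic_step_gt0 n : 0 < dyadic_step n.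
Proof. by rewrite /dyadic_step divr_gt0// ltr0n expn_gt0. Qed.

Lemma dyadic_stepT n : dyadic_step n * (2 ^ n)%:R = T.
Proof. by rewrite /dyadic_step divfK// pnatr_eq0 -lt0n expn_gt0. Qed.

Lemma dyadic_stepS n : dyadic_step n = dyadic_step n.+1 * 2%:R.
Proof.
have : (2 ^ n)%:R != 0 :> R by rewrite pnatr_eq0 expn_eq0.
by rewrite /dyadic_step expnS natrM; move: (2 ^ n)%:R => p p0; field.
Qed.

Lemma dyadic_stepM n k :
  dyadic_step n * k%:R = dyadic_step n.+1 * (2 * k)%:R.
Proof. by rewrite dyadic_stepS natrM mulrA. Qed.

Lemma dyadic_innerP n x : dyadic_inner n x <->
  exists2 k, (k < 2 ^ n)%N & dyadic_cell n k x /\ dyadic_cell n k `<=` U.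
Proof.
have -> : dyadic_inner n = \bigcup_(k in [set` [pred k : 'I_(2 ^ n) |
    `[< dyadic_cell n k `<=` U >]]]) dyadic_cell n k by rewrite bigcup_pred.
split=> [[k /= /asboolP kU kx]|[k kn [kx kU]]].
  by exists k.
by exists (Ordinal kn) => //=; exact/asboolP.
Qed.

Lemma dyadic_inner_sub n : dyadic_inner n `<=` U.
Proof. by move=> x /dyadic_innerP[k _ [kx]]; exact. Qed.

Lemma dyadic_inner_nondecreasing : nondecreasing_seq dyadic_inner.
Proof.
apply/nondecreasing_seqP => n; apply/subsetPset => x /dyadic_innerP[k kn [+ kU]].
rewrite /dyadic_cell /= in_itv/= !(dyadic_stepM n) => /andP[kx xk].
have s0 := dyadic_step_gt0 n.+1.
have sub k' : (2 * k <= k')%N -> (k'.+1 <= 2 * k.+1)%N ->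
    dyadic_cell n.+1 k' `<=` U.
  move=> k1 k2 y; rewrite /dyadic_cell/= in_itv/= => /andP[y1 y2]; apply: kU.
  rewrite /dyadic_cell /= in_itv/= !(dyadic_stepM n); apply/andP; split.
    by apply: le_lt_trans y1; rewrite ler_pM2l// ler_nat.
  by apply: (le_trans y2); rewrite ler_pM2l// ler_nat.
apply/dyadic_innerP.
have [xm|mx] := leP x (dyadic_step n.+1 * (2 * k).+1%:R).
  exists (2 * k)%N; first by rewrite expnS ltn_pmul2l.
  split; last by apply: sub => //; rewrite mulnS.
  by rewrite /dyadic_cell /= in_itv/= kx.
exists (2 * k).+1; first by rewrite expnS -add2n -mulnS leq_pmul2l.
split; last by apply: sub => //; rewrite mulnS.
by rewrite /dyadic_cell /= in_itv/= mx; move: xk; rewrite mulnS.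
Qed.

Lemma dyadic_inner_cover : open U -> U `&` `]0, T] `<=` \bigcup_n dyadic_inner n.
Proof.
move=> oU x [Ux]; rewrite /= in_itv/= => /andP[x0 xT].
have /nbhs_ballP[e/= e0 eU] : nbhs x U by exact: open_nbhs_nbhs.
have [n ne] : exists n, dyadic_step n < e.
  exists (Num.truncn (T / e)).+1.
  rewrite /dyadic_step ltr_pdivrMr ?ltr0n ?expn_gt0// mulrC -ltr_pdivrMr//.
  by apply: (lt_trans (truncnS_gt _)); rewrite ltr_nat ltn_expl.
have s0 := dyadic_step_gt0 n.
have [k [kx xk]] : exists k : nat, dyadic_step n * k%:R < x /\
    x <= dyadic_step n * k.+1%:R.
  have ex : exists k : nat, x <= dyadic_step n * k%:R.
    by exists (2 ^ n)%N; rewrite dyadic_stepT.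
  case: (ex_minnP ex) => -[|k]; first by rewrite mulr0 leNgt x0.
  by move=> xk min; exists k; split => //; rewrite ltNge; apply/negP => /min; rewrite ltnn.
exists n => //; apply/dyadic_innerP; exists k.
  by rewrite -(ltr_nat R) -(ltr_pM2l s0) dyadic_stepT (lt_le_trans kx).
split; first by rewrite /dyadic_cell /= in_itv/= kx.
move=> y; rewrite /dyadic_cell/= in_itv/= => /andP[ky yk].
apply: eU; rewrite /ball/= ltr_norml; apply/andP.
move: kx xk ky yk ne; rewrite mulrSr mulrDr mulr1; lra.
Qed.

(** Meant for two measures, the Stieltjes measure of [v] and, with [v] the identity, Lebesgue
    measure: both become sums over one family of segments, as in [seg_ac]. *)
Lemma measure_dyadic_inner (mu : {measure set (measurableTypeR R) -> \bar R})
    (v : R -> R) n :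
  (forall k, (k < 2 ^ n)%N -> mu (dyadic_cell n k) =
    (v (dyadic_step n * k.+1%:R) - v (dyadic_step n * k%:R))%:E) ->
  mu (dyadic_inner n) = (\sum_(x <- [seq (dyadic_step n * k%:R, dyadic_step n * k.+1%:R)
    | k <- iota 0 (2 ^ n) & `[< dyadic_cell n k `<=` U >]]) (v x.2 - v x.1))%:E.
Proof.
move=> muv; rewrite /dyadic_inner measure_bigsetU_ord_cond.
- rewrite big_map big_filter.
  have -> : iota 0 (2 ^ n) = index_iota 0 (2 ^ n) by rewrite /index_iota subn0.
  rewrite big_mkord.
  by rewrite -sumEFin; apply: eq_bigr => k _; exact: (muv k (ltn_ord k)).
- move=> k _; change (measurable (dyadic_cell n k : set (measurableTypeR R))).
  by apply: sub_sigma_algebra; exact: is_ocitv.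
- move=> i j _ _ [x []].
  rewrite /dyadic_cell/= !in_itv/= => /andP[ix xi] /andP[jx xj].
  have s0 := dyadic_step_gt0 n.
  have := lt_le_trans ix xj; rewrite ltr_pM2l// ltr_nat ltnS => ij1.
  have := lt_le_trans jx xi; rewrite ltr_pM2l// ltr_nat ltnS => ji1.
  by apply/val_inj/eqP; rewrite eqn_leq/= ij1.
Qed.

End dyadic_cells.

(** * Densities and almost everywhere derivatives *)

Lemma nondecreasing_ac_density (R : realType) (T : R) (v : R -> R) : 0 < T ->
  (forall x y, 0 <= x -> x <= y -> y <= T -> v x <= v y) ->
  seg_ac T (fun x => v x.2 - v x.1) ->
  exists2 g : R -> R,
    (@lebesgue_measure R).-integrable setT (EFin \o g) &
    forall x y, 0 <= x -> x <= y -> y <= T ->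
      (\int[lebesgue_measure]_(r in `]x, y]) (g r)%:E = (v y - v x)%:E)%E.
Proof.
move=> T0 v_nd v_ac.
(* A Stieltjes measure needs a monotone right-continuous function on the whole line, so [v] is
   extended by constants outside [[0, T]]. *)
pose cl x := Num.max 0 (Num.min x T); pose w x := v (cl x).
have cl0 x : 0 <= cl x by rewrite /cl le_max lexx.
have clT x : cl x <= T by rewrite /cl ge_max (ltW T0) ge_min lexx orbT.
have cl_id x : 0 <= x -> x <= T -> cl x = x.
  by move=> x0 xT; rewrite /cl min_l// max_r.
have cl_nd x y : x <= y -> cl x <= cl y.
  move=> xy; rewrite /cl ge_max !le_max lexx/=.
  by rewrite [in X in _ || X]le_min !ge_min xy/= lexx !orbT.
have cl_lip x y : x <= y -> cl y - cl x <= y - x.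
  move=> xy; rewrite lerBlDl {1}/cl ge_max addr_ge0 ?subr_ge0//=.
  have [xT|Tx] := leP x T.
    apply: (@le_trans _ _ y); first by rewrite ge_min lexx.
    by rewrite -[leLHS](subrKC x) lerD2r /cl min_l// le_max lexx orbT.
  have -> : cl x = T by rewrite /cl min_r ?(ltW Tx)// max_r// ltW.
  by rewrite ge_min lerDl subr_ge0 xy orbT.
have w_nd : nondecreasing w by move=> x y xy; apply: v_nd => //; exact: cl_nd.
have w_rc : forall x, w @ x^'+ --> w x.
  move=> x; apply/cvgrPdist_le => e e0.
  have [d d0 vd] := v_ac e e0.
  near=> y; have xy : x < y by near: y; exact: nbhs_right_gt.
  have yxd : y - x < d.
    by rewrite ltrBlDl; near: y; apply: nbhs_right_lt; rewrite ltrDl.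
  have wxy := w_nd _ _ (ltW xy).
  rewrite ler0_norm ?subr_le0// opprB.
  have := cl_nd _ _ (ltW xy); rewrite le_eqVlt => /predU1P[cxy|cxy].
    by rewrite /w cxy subrr ltW.
  have := vd [:: (cl x, cl y)]; rewrite !big_seq1/=; apply.
    by split => //=; rewrite /seg_next/= cl0 cxy.
  by apply: le_lt_trans yxd; exact: cl_lip (ltW xy).
pose f : cumulative R R := HB.pack w (isCumulative.Build R _ R w w_nd w_rc).
pose nu0 := lebesgue_stieltjes_measure f.
have nu0E (a b : R) : a <= b -> nu0 `]a, b]%classic = (w b - w a)%:E.
  move=> ab; rewrite /nu0 /lebesgue_stieltjes_measure /measure_extension.
  by rewrite measurable_mu_extE/= ?wlength_itv_bnd//; exact: is_ocitv.
pose D : set (measurableTypeR R) := `]0, T]%classic.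
have mD : measurable D by apply: sub_sigma_algebra; exact: is_ocitv.
have Dfin : (nu0 D < +oo)%E by rewrite /D nu0E ?ltry// ltW.
pose nu : {finite_measure set (measurableTypeR R) -> \bar R} := mfrestr mD Dfin.
(* A null set lies in an open set of Lebesgue measure below [d]. Absolute continuity bounds the
   Stieltjes mass of every [dyadic_inner T U n] by [e], and the bound passes to the increasing
   limit. *)
have nu_mu : nu `<< @lebesgue_measure R.
  apply/null_content_dominatesP => A mA A0.
  apply/eqP; rewrite eq_le measure_ge0 andbT; apply/lee_addgt0Pr => e e0.
  rewrite add0e.
  have [d d0 vd] := v_ac e e0.
  have [|U [oU AU mU]] := @lebesgue_regularity_outer R A d mA _ d0.
    by rewrite A0.
  have mU' : measurable (U : set (measurableTypeR R)).
    exact: measurable_realfun.open_measurable.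
  have Ud : (lebesgue_measure U < d%:E)%E.
    rewrite (measureDI _ mU' mA)//=.
    have -> : (lebesgue_measure (U `&` A) = 0)%E.
      apply/eqP; rewrite eq_le measure_ge0 andbT -A0.
      by apply: le_measure; rewrite ?inE//; exact: measurableI.
    by rewrite adde0.
  have mI n : measurable (dyadic_inner T U n : set (measurableTypeR R)).
    apply: bigsetU_measurable => k _.
    by apply: sub_sigma_algebra; exact: is_ocitv.
  have mIU : measurable (\bigcup_n dyadic_inner T U n : set (measurableTypeR R)).
    exact: bigcup_measurable.
  have st n k : (k < 2 ^ n)%N -> dyadic_step T n * k.+1%:R <= T.
    move=> kn; rewrite -[leRHS](dyadic_stepT T n).
    by rewrite ler_pM2l ?ler_nat// dyadic_step_gt0.
  have st0 n k : dyadic_step T n * k%:R <= dyadic_step T n * k.+1%:R.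
    by rewrite ler_pM2l ?dyadic_step_gt0// ler_nat.
  have st00 n k : 0 <= dyadic_step T n * k%:R.
    by rewrite mulr_ge0// ltW// dyadic_step_gt0.
  have nuI n : (nu0 (dyadic_inner T U n) <= e%:E)%E.
    have nuE := @measure_dyadic_inner _ _ T0 U nu0 v n _.
    rewrite (nuE _ : nu0 (dyadic_inner T U n) = _); last first.
      move=> k kn; rewrite [LHS]nu0E// /w !cl_id//; last exact: st.
      exact: le_trans (st0 _ _) (st _ _ kn).
    rewrite lee_fin; apply: vd.
      have [|p1 p2] := @segs_grid R (dyadic_step T n)
        (fun k => `[< dyadic_cell T n k `<=` U >]) (2 ^ n) 0 (0, 0)
        (dyadic_step_gt0 T0 n); first by rewrite mulr0.
      by split => //; rewrite (le_trans p2)// add0n dyadic_stepT.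
    have : (lebesgue_measure (dyadic_inner T U n) < d%:E)%E.
      apply: le_lt_trans Ud; apply: le_measure; rewrite ?inE//.
      exact: dyadic_inner_sub.
    have muE := @measure_dyadic_inner _ _ T0 U lebesgue_measure id n _.
    rewrite (muE _ : lebesgue_measure (dyadic_inner T U n) = _)//.
    move=> k kn; rewrite [LHS]lebesgue_measure_itv/= lte_fin.
    by rewrite ltr_pM2l ?dyadic_step_gt0// ltr_nat ltnSn -EFinB.
  apply: (@le_trans _ _ (nu0 (\bigcup_n dyadic_inner T U n))).
    apply: le_measure; rewrite ?inE//; first exact: measurableI.
    by move=> x [Ax Dx]; apply: (dyadic_inner_cover T0 oU); split => //; exact: AU.
  have cv : nu0 (dyadic_inner T U n) @[n --> \oo] -->
      nu0 (\bigcup_n dyadic_inner T U n).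
    exact: (nondecreasing_cvg_mu mI mIU (dyadic_inner_nondecreasing T0 U)).
  rewrite -(cvg_lim (@ereal_hausdorff _) cv); apply: lime_le.
    by apply/cvg_ex; eexists; exact: cv.
  exact: nearW.
have [g [g0 gfin gint gE]] := radon_nikodym_sigma_finite nu_mu.
have gK : EFin \o (fine \o g) = g.
  by apply/funext => r /=; rewrite fineK.
exists (fine \o g); first by rewrite gK.
move=> x y x0 xy yT.
under eq_integral do rewrite /= fineK//.
rewrite -(gE `]x, y]%classic); last by apply: sub_sigma_algebra; exact: is_ocitv.
have xyD : `]x, y]%classic `&` D = `]x, y]%classic.
  apply/setIidl => r; rewrite /D /= !in_itv/= => /andP[xr ry].
  by rewrite (le_lt_trans x0 xr) (le_trans ry yT).
have -> : nu `]x, y]%classic = nu0 `]x, y]%classic.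
  by rewrite -[in RHS]xyD.
have y0 := le_trans x0 xy; have xT := le_trans xy yT.
by rewrite [LHS]nu0E// /w !cl_id.
Unshelve. all: by end_near. Qed.

Lemma ac_derivative (R : realType) (T : R) (f : R -> R) : 0 < T ->
  seg_ac T (fun x => `|f x.2 - f x.1|) ->
  exists g : R -> R, [/\
    (@lebesgue_measure R).-integrable setT (EFin \o g),
    (forall x y, 0 <= x -> x <= y -> y <= T ->
      (\int[lebesgue_measure]_(r in `]x, y]) (g r)%:E = (f y - f x)%:E)%E) &
    {ae @lebesgue_measure R, forall r, 0 < r < T -> is_derive r 1 f (g r)}].
Proof.
move=> T0 acf.
have [v [v_nd v_ac] [w_nd w_ac]] := seg_ac_decomposition T0 acf.
have [g1 ig1 Eg1] := nondecreasing_ac_density T0 v_nd v_ac.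
have [g2 ig2 Eg2] := nondecreasing_ac_density T0 w_nd w_ac.
pose g r := g2 r - g1 r.
have ig : (@lebesgue_measure R).-integrable setT (EFin \o g).
  have -> : EFin \o g = ((EFin \o g2) \- (EFin \o g1))%E by [].
  exact: integrableB.
have igS (A : set R) : measurable A ->
    (@lebesgue_measure R).-integrable A (EFin \o g).
  by move=> mA; apply: integrableS ig.
have Eg x y : 0 <= x -> x <= y -> y <= T ->
    (\int[lebesgue_measure]_(r in `]x, y]) (g r)%:E = (f y - f x)%:E)%E.
  move=> x0 xy yT; under eq_integral do rewrite /g EFinB.
  rewrite integralB//=.
  - by rewrite Eg1// Eg2// -EFinB; congr EFin; ring.
  - by apply: integrableS ig2.
  - by apply: integrableS ig1.
exists g; split => //.
have := @FTC1Ny R g (fun y => igS _ (measurable_itv _))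
  (open_integrable_locally openT ig).
apply: filterS; first exact: (ae_filter_ringOfSetsType lebesgue_measure).
move=> r [dF FE] /andP[r0 rT].
set F := (fun x => _) in dF FE.
(* On [(0, T)] the primitive [F] and [f] have the same increments, so they differ by the constant
   [f 0 - F 0]. *)
apply: (@near_eq_is_derive _ _ _ (F + cst (f 0 - F 0))); last first.
  rewrite -[g r]addr0; apply: is_deriveD.
  apply: DeriveDef; first exact: dF.
  by rewrite -derive1E.
near=> y.
have y0 : 0 < y by near: y; exact: lt_nbhsr.
have yT : y < T by near: y; exact: lt_nbhsl.
have : F y - F 0 = f y - f 0.
  rewrite /F Rintegral_itvB// ?bnd_simp// ?ltW//; last exact: igS.
  by rewrite /Rintegral (Eg 0 y (lexx _) (ltW y0) (ltW yT)).
by move=> FB; rewrite -[LHS]/(F y + (f 0 - F 0)); lra.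
Unshelve. all: by end_near. Qed.

(** * Lower bounds for the action *)

(* No measurability is required: the integral of a nonnegative function is a
   supremum of integrals of simple functions below it. *)
Lemma le_integral_pointwise d (X : measurableType d) (R : realType)
    (mu : {measure set X -> \bar R}) (D : set X) (f g : X -> \bar R) :
  (forall x, D x -> (f x <= g x)%E) ->
  (\int[mu]_(x in D) f x <= \int[mu]_(x in D) g x)%E.
Proof.
move=> fg; rewrite /integral.
have fgD x : ((f \_ D) x <= (g \_ D) x)%E.
  by rewrite !patchE; case: ifPn => // /set_mem /fg.
apply: leeB; apply: ereal_sup_le => _ [h /= hf <-]; exists h => //= x.
  apply: (le_trans (hf x)); rewrite !funeposE.
  by rewrite ge_max le_max fgD/= le_max lexx orbT.
apply: (le_trans (hf x)); rewrite !funenegE.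
by rewrite ge_max le_max leeN2 fgD/= le_max lexx orbT.
Qed.

Lemma coord_le_enorm (R : realType) (N : nat) (p : 'rV[R]_N) k :
  `|p ord0 k| <= enorm p.
Proof.
rewrite /enorm -sqrtr_sqr ler_sqrt ?sumr_ge0//; last first.
  by move=> i _; rewrite -expr2 sqr_ge0.
rewrite /dotv (bigD1 k)//= -expr2 lerDl sumr_ge0// => i _.
by rewrite -expr2 sqr_ge0.
Qed.

Lemma seg_next_trans (R : realType) : transitive (@seg_next R).
Proof.
move=> y x z /andP[xy yy] /andP[yz zz]; rewrite /seg_next zz andbT.
exact: le_trans xy (le_trans (ltW yy) yz).
Qed.

(** Ordered segments are pairwise disjoint, so the condition on families indexed by ordinals applies
    to lists; each coordinate is dominated by [enorm]. *)
Lemma seg_ac_coord (R : realType) (N : nat) (T : R) (f : R -> 'rV[R]_N) :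
  (forall e : R, 0 < e -> exists2 d : R, 0 < d &
    forall (n : nat) (a b : 'I_n -> R),
      (forall k, 0 <= a k /\ a k < b k /\ b k <= T) ->
      trivIset setT (fun k => `]a k, b k[%classic) ->
      \sum_(k < n) (b k - a k) < d ->
      \sum_(k < n) enorm (f (b k) - f (a k)) < e) ->
  forall k, seg_ac T (fun x => `|f x.2 ord0 k - f x.1 ord0 k|).
Proof.
move=> acf k e e0; have [d d0 fd] := acf e e0; exists d => // l sl ld.
pose a (i : 'I_(size l)) := (nth (0, 0) l i).1.
pose b (i : 'I_(size l)) := (nth (0, 0) l i).2.
have sumE (F : R * R -> R) : \sum_(x <- l) F x = \sum_(i < size l) F (a i, b i).
  rewrite (big_nth (0, 0)) big_mkord; apply: eq_bigr => i _.
  by rewrite /a /b -surjective_pairing.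
rewrite sumE in ld; rewrite sumE/=.
have {fd} := fd _ a b _ _ ld.
move=> /(_ _ _)/ltW fle; apply: le_trans (fle _ _).
- apply: ler_sum => i _; apply: le_trans (coord_le_enorm _ k).
  by rewrite !mxE.
- move=> i; have /(seg_bounds sl)[] : nth (0, 0) l i \in l by exact: mem_nth.
  by [].
- move=> i j _ _ [x [/=]]; rewrite !in_itv/= => /andP[ax xb] /andP[ax' xb'].
  have lsort : sorted (@seg_next R) l by case: sl => /path_sorted.
  have nx := sorted_ltn_nth (@seg_next_trans R) (0, 0) lsort.
  apply/val_inj/eqP; rewrite eqn_leq; apply/andP; split; rewrite leqNgt;
    apply/negP => ij; have := nx _ _ (ltn_ord _) (ltn_ord _) ij;
    move=> /andP[+ _]; apply/negP; rewrite -ltNge.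
  - exact: lt_trans ax xb'.
  - exact: lt_trans ax' xb.
Qed.

(* Lowering [G] to [-oo] on the null set where [P] may fail makes the comparison
   pointwise, so that [l] need not be measurable. *)
Lemma ae_lower_bound d (X : measurableType d) (R : realType)
    (mu : {measure set X -> \bar R}) (D : set X) (G l : X -> R) (P : X -> Prop) :
  measurable D -> mu.-integrable D (EFin \o G) ->
  {ae mu, forall r, P r} ->
  (forall r, D r -> P r -> G r <= l r) ->
  (\int[mu]_(r in D) (G r)%:E <= \int[mu]_(r in D) (l r)%:E)%E.
Proof.
move=> mD iG [A [mA A0 PA]] Gl.
pose h r : \bar R := if r \in A then -oo%E else (G r)%:E.
case/integrableP : (iG) => mG _.
rewrite (@ae_eq_integral _ _ _ mu D h)//.
- apply: le_integral_pointwise => r Dr; rewrite /h; case: ifPn => [_|/negP rA].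
    exact: leNye.
  rewrite lee_fin; apply: Gl => //; apply: contrapT => nP.
  by apply: rA; rewrite inE; exact: PA.
- apply: measurable_fun_if => //.
  + apply: (measurable_fun_bool true).
    rewrite (_ : _ @^-1` _ = A); first exact: measurableI.
    by apply/seteqP; split => r /=; [move=> /set_mem|move=> /mem_set].
  + exact: measurable_funS mG.
- exists A; split => // r /= /not_implyP[Dr].
  by rewrite /h; case: ifPn => // /set_mem.
Qed.

(** As [p] does not depend on time, absolute continuity turns the integral of the velocity term into
    the exact increment [dotv p (f s - f t)]. *)
Lemma action_lower_bound (R : realType) (N : nat) (T : R) (f : R -> 'rV[R]_N.+1)
    (l : R -> R) (p : 'rV[R]_N.+1) (K s t : R) :
  (forall k, seg_ac T (fun x => `|f x.2 ord0 k - f x.1 ord0 k|)) ->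
  0 <= s -> s < t -> t <= T ->
  (forall r, s <= r <= t -> dotv p (- derive1 f r) - K <= l r) ->
  ((dotv p (f s - f t) - K * (t - s))%:E <=
    \int[lebesgue_measure]_(r in `[s, t]) (l r)%:E)%E.
Proof.
move=> acf s0 st tT pl.
have T0 : 0 < T by apply: lt_le_trans tT; exact: le_lt_trans st.
have /choice[g gP] : forall k, exists g : R -> R, [/\
    (@lebesgue_measure R).-integrable setT (EFin \o g),
    (forall x y, 0 <= x -> x <= y -> y <= T ->
      (\int[lebesgue_measure]_(r in `]x, y]) (g r)%:E =
        (f y ord0 k - f x ord0 k)%:E)%E) &
    {ae @lebesgue_measure R, forall r, 0 < r < T ->
      is_derive r 1 (fun r => f r ord0 k) (g r)}].
  by move=> k; exact: (@ac_derivative R T (fun r => f r ord0 k) T0 (acf k)).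
pose G r := \sum_(k < N.+1) - p ord0 k * g k r - K.
have igk k (A : set R) : measurable A -> (@lebesgue_measure R).-integrable A
    (fun r => (- p ord0 k)%:E * (g k r)%:E)%E.
  move=> mA; apply: integrableZl => //.
  by apply: integrableS (_ : lebesgue_measure.-integrable setT _) => //; case: (gP k).
have GE : EFin \o G = (fun r =>
    \sum_(k < N.+1) ((- p ord0 k)%:E * (g k r)%:E) - (cst K r)%:E)%E.
  apply/funext => r; rewrite /G /comp EFinB -sumEFin.
  by congr (_ - _)%E; apply: eq_bigr => k _; rewrite EFinM.
have iS (A : set R) : measurable A -> (@lebesgue_measure R).-integrable A
    (fun r => \sum_(k < N.+1) ((- p ord0 k)%:E * (g k r)%:E))%E.
  by move=> mA; apply: integrable_sum => // k _; exact: igk.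
have mst : (lebesgue_measure `[s, t] < +oo)%E.
  by rewrite lebesgue_measure_itv/= lte_fin st -EFinB ltry.
have iK : (@lebesgue_measure R).-integrable `[s, t] (EFin \o cst K).
  apply/integrableP; split; first exact/measurable_EFinP.
  under eq_integral do rewrite /=.
  by rewrite integral_cst//= lte_mul_pinfty.
have iG : (@lebesgue_measure R).-integrable `[s, t] (EFin \o G).
  by rewrite GE; apply: integrableB => //; exact: iS.
have intG : (\int[lebesgue_measure]_(r in `[s, t]) (G r)%:E =
    (dotv p (f s - f t) - K * (t - s))%:E)%E.
  rewrite -[LHS]/(\int[lebesgue_measure]_(r in `[s, t]) (EFin \o G) r)%E GE.
  rewrite integralB//=; last exact: iS.
  rewrite integral_cst//= lebesgue_measure_itv/= lte_fin st -EFinB -EFinM.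
  rewrite integral_sum//; last by move=> k; exact: igk.
  rewrite EFinB; congr (_ - _)%E; rewrite /dotv -sumEFin; apply: eq_bigr => k _.
  have [ig Eg _] := gP k.
  rewrite -integral_itv_obnd_cbnd; last first.
    by case/integrableP : (igk k `]s, t]%classic (measurable_itv _)).
  rewrite integralZl//; last by apply: integrableS ig.
  rewrite (Eg s t s0 (ltW st) tT) -EFinM !mxE; congr EFin; ring.
rewrite -intG.
(* Discarding the end points ensures [0 < r < T], even when [s = 0] or [t = T]. *)
pose P r := [/\ r != s, r != t & forall k, 0 < r < T ->
  is_derive r 1 (fun r => f r ord0 k) (g k r)].
have aeP : {ae @lebesgue_measure R, forall r, P r}.
  have FF := ae_filter_ringOfSetsType (@lebesgue_measure R).
  have ne x : {ae @lebesgue_measure R, forall r, r != x}.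
    exists [set x]; split => //; first exact: lebesgue_measure_set1.
    by move=> r /= /negP; rewrite negbK => /eqP.
  have ak : {ae @lebesgue_measure R, forall r, forall k, 0 < r < T ->
      is_derive r 1 (fun r => f r ord0 k) (g k r)}.
    by apply: filter_forall => k; case: (gP k).
  near=> r; split.
  - by near: r; exact: ne.
  - by near: r; exact: ne.
  - by near: r; exact: ak.
apply: (ae_lower_bound _ _ aeP) => // r.
rewrite /= in_itv/= => /andP[sr rt] [rs rt' dr].
apply: le_trans (pl r _); last by rewrite sr.
rewrite /G lerD2r /dotv; apply: ler_sum => k _.
have sr' : s < r by rewrite lt_neqAle eq_sym rs.
have rlt : r < t by rewrite lt_neqAle rt'.
have r0T : 0 < r < T by rewrite (le_lt_trans s0 sr') (lt_le_trans rlt tT).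
have dfr : derivable f r 1.
  by apply/derivable_mxP => i j; rewrite (ord1 i); have [] := dr j r0T.
rewrite derive1E derive_mx// !mxE.
have [_ ->] := dr k r0T.
by rewrite mulNr mulrN.
Unshelve. all: by end_near. Qed.

(** * Viscosity subsolutions along segments *)

(** A C^1 function with an explicit formula for its differential, so that the rules below compute
    the time derivative and the gradient of [tube_test]. *)
Definition C1_with (R : realType) (V : normedModType R) (f : V -> R)
    (df : V -> V -> R) : Prop :=
  [/\ forall z, differentiable f z, forall z v, 'd f z v = df z v &
    forall v, continuous (df ^~ v)].

Section C1_with.
Context {R : realType} {V : normedModType R}.
Implicit Types (f g : V -> R) (df dg : V -> V -> R).

Lemma C1_with_cst (c : R) : @C1_with R V (fun=> c) (fun _ _ => 0).
Proof.
split=> [z|z v|v].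
- exact: differentiable_cst.
- by rewrite (diff_cst c).
- exact: cst_continuous.
Qed.

Lemma C1_with_linear (f : {linear V -> R}) : continuous f ->
  C1_with f (fun _ v => f v).
Proof.
move=> cf; split=> [z|z v|v].
- exact: linear_differentiable.
- by rewrite diff_lin.
- exact: cst_continuous.
Qed.

Lemma C1_withD f g df dg : C1_with f df -> C1_with g dg ->
  C1_with (fun z => f z + g z) (fun z v => df z v + dg z v).
Proof.
move=> [f1 f2 f3] [g1 g2 g3]; split=> [z|z v|v z].
- exact: differentiableD.
- by rewrite (diffD (f1 z) (g1 z)) -f2 -g2.
- by apply: cvgD; [exact: f3|exact: g3].
Qed.

Lemma C1_withM f g df dg : C1_with f df -> C1_with g dg ->
  C1_with (fun z => f z * g z) (fun z v => f z * dg z v + g z * df z v).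
Proof.
move=> [f1 f2 f3] [g1 g2 g3]; split=> [z|z v|v z].
- exact: differentiableM.
- by rewrite (diffM (f1 z) (g1 z)) -f2 -g2.
- by apply: cvgD; apply: cvgM; [exact: differentiable_continuous|exact: g3|
    exact: differentiable_continuous|exact: f3].
Qed.

Lemma C1_with_eq f df dg : (forall z v, df z v = dg z v) ->
  C1_with f df -> C1_with f dg.
Proof.
by move=> dfg; have -> : df = dg by apply/funext => z; apply/funext => v.
Qed.

Lemma C1_withZ f df (c : R) : C1_with f df ->
  C1_with (fun z => c * f z) (fun z v => c * df z v).
Proof.
move=> fdf; apply: C1_with_eq (C1_withM (C1_with_cst c) fdf) => z v.
by rewrite mulr0 addr0.
Qed.

Lemma C1_withX f df n : C1_with f df ->
  C1_with (fun z => f z ^+ n) (fun z v => n%:R * f z ^+ n.-1 * df z v).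
Proof.
move=> fdf; elim: n => [|n ih].
  under eq_fun do rewrite expr0.
  by apply: C1_with_eq (C1_with_cst 1) => z v; rewrite !mul0r.
under eq_fun do rewrite exprS.
apply: C1_with_eq (C1_withM fdf ih) => z v /=.
case: n {ih} => [|n /=]; first by rewrite !mul0r mulr0 !expr0 add0r !mul1r.
by rewrite exprS -natr1; ring.
Qed.

Lemma C1_with_sum n (f : 'I_n -> V -> R) (df : 'I_n -> V -> V -> R) :
  (forall k, C1_with (f k) (df k)) ->
  C1_with (fun z => \sum_(k < n) f k z) (fun z v => \sum_(k < n) df k z v).
Proof.
move=> fdf; rewrite /index_enum; elim: (Finite.enum _) => [|k s ih].
  under eq_fun do rewrite big_nil.
  by apply: C1_with_eq (C1_with_cst 0) => z v; rewrite big_nil.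
under eq_fun do rewrite big_cons.
by apply: C1_with_eq (C1_withD (fdf k) ih) => z v; rewrite big_cons.
Qed.

Lemma C1_withP f df (A : set V) : C1_with f df -> C1_on A f.
Proof.
move=> [f1 f2 f3] z _; split => // v.
suff -> : (fun y => 'd f y v) = df ^~ v by exact: f3.
by apply/funext => y; exact: f2.
Qed.

End C1_with.

Lemma C1_with_time (R : realType) (V : normedModType R) :
  C1_with (fun z : R * V => z.1) (fun _ v => v.1).
Proof.
have lf : linear (fun z : R * V => z.1 : R^o) by move=> c x y.
pose f : {linear (R * V)%type -> R^o} := HB.pack (fun z : R * V => z.1 : R^o)
  (GRing.isLinear.Build _ _ _ _ _ lf).
by apply: (@C1_with_linear _ _ f) => z; exact: cvg_fst.
Qed.

Lemma C1_with_space (R : realType) (N : nat) (k : 'I_N) :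
  C1_with (fun z : R * 'rV[R]_N => z.2 ord0 k) (fun _ v => v.2 ord0 k).
Proof.
have lf : linear (fun z : R * 'rV[R]_N => z.2 ord0 k : R^o).
  by move=> c x y; rewrite /= !mxE.
pose f : {linear (R * 'rV[R]_N)%type -> R^o} :=
  HB.pack (fun z : R * 'rV[R]_N => z.2 ord0 k : R^o)
  (GRing.isLinear.Build _ _ _ _ _ lf).
apply: (@C1_with_linear _ _ f) => z.
apply: (@continuous_comp _ _ _ snd (fun m : 'rV[R]_N => m ord0 k)).
  exact: cvg_snd.
exact: coord_continuous.
Qed.

Section tube_test_function.
Context {R : realType} {N : nat} (y q : 'rV[R]_N) (s th M A K : R) (n : nat).

Definition tube_gap (z : R * 'rV[R]_N) : 'rV[R]_N := z.2 - y - (z.1 - s) *: q.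

(* For large [n] the second term is negligible at an interior time and prohibitive at
   [z.1 = s + th]; the third one confines maxima to the tube around [y + (z.1 - s) q]. *)
Definition tube_test (z : R * 'rV[R]_N) : R :=
  M * (z.1 - s) + A * ((z.1 - s) / th) ^+ n +
  K * \sum_(k < N) tube_gap z ord0 k ^+ 2.

Definition tube_test_diff (z v : R * 'rV[R]_N) : R :=
  M * v.1 + A * (n%:R * ((z.1 - s) / th) ^+ n.-1 * (v.1 / th)) +
  K * \sum_(k < N) 2 * tube_gap z ord0 k * (v.2 ord0 k - v.1 * q ord0 k).

Lemma C1_with_tube_test : C1_with tube_test tube_test_diff.
Proof.
have C1t : C1_with (fun z : R * 'rV[R]_N => z.1 - s) (fun _ v => v.1).
  apply: C1_with_eq (C1_withD (C1_with_time _) (C1_with_cst (- s))) => z v.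
  by rewrite addr0.
apply: C1_withD; first apply: C1_withD; apply: C1_withZ => //.
- have C1h : C1_with (fun z : R * 'rV[R]_N => (z.1 - s) / th)
      (fun _ v => v.1 / th).
    apply: C1_with_eq (C1_withM C1t (C1_with_cst th^-1)) => z v.
    by rewrite mulr0 add0r mulrC.
  exact: (C1_withX n C1h).
- apply: C1_with_sum => k.
  have C1g : C1_with (fun z : R * 'rV[R]_N => tube_gap z ord0 k)
      (fun _ v => v.2 ord0 k - v.1 * q ord0 k).
    have -> : (fun z : R * 'rV[R]_N => tube_gap z ord0 k) =
        (fun z => (z.2 ord0 k + - y ord0 k) + (- q ord0 k) * (z.1 - s)).
      by apply/funext => z; rewrite /tube_gap !mxE; ring.
    have C1k := C1_withD (C1_withD (@C1_with_space R N k)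
      (C1_with_cst (- y ord0 k))) (C1_withZ (- q ord0 k) C1t).
    by apply: C1_with_eq C1k => z v; ring.
  exact: (C1_withX 2 C1g).
Qed.

(** The last term is minus the pairing of [q] with the spatial gradient, so the subsolution
    inequality will contain precisely the quantity [dotv p q - h z p - b r z] of [tubeM0]. *)
Lemma tube_test_time z :
  time_deriv tube_test z = M + A * (n%:R * ((z.1 - s) / th) ^+ n.-1 / th) -
    dotv (\row_k (K * 2 * tube_gap z ord0 k)) q.
Proof.
have [d1 d2 _] := C1_with_tube_test.
rewrite /time_deriv deriveE// d2 /tube_test_diff /= !mulr1 mul1r; congr (_ + _ + _).
rewrite /dotv -sumrN mulr_sumr; apply: eq_bigr => k _; rewrite !mxE; ring.
Qed.

Lemma tube_test_grad z :
  space_grad tube_test z = \row_k (K * 2 * tube_gap z ord0 k).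
Proof.
have [d1 d2 _] := C1_with_tube_test.
apply/rowP => k; rewrite !mxE deriveE// d2 /tube_test_diff /= mulr0 add0r.
rewrite mul0r mulr0 mulr0 add0r (bigD1 k)//= big1 ?addr0.
  by rewrite /tube_gap !mxE !eqxx /=; ring.
by move=> j jk; rewrite !mxE eqxx (negbTE jk) /=; ring.
Qed.

End tube_test_function.

Lemma norm_coord_le (R : realType) (N : nat) (p : 'rV[R]_N.+1) k :
  `|p ord0 k| <= `|p|.
Proof. by rewrite [leRHS]/Num.norm/= mx_normrE (le_bigmax _ _ (ord0, k)). Qed.

Lemma norm_coord_eq (R : realType) (N : nat) (p : 'rV[R]_N.+1) :
  exists k, `|p| = `|p ord0 k|.
Proof.
suff [[i k] e] : exists ij : 'I_1 * 'I_N.+1, `|p| = `|p ij.1 ij.2|.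
  by exists k; rewrite e (ord1 i).
rewrite [X in exists ij, X = _]/Num.norm/= mx_normrE.
have := @bigmax_eq_arg _ R _ 0 (ord0, ord0) xpredT
  (fun ij : 'I_1 * 'I_N.+1 => `|p ij.1 ij.2|) isT (fun _ _ => normr_ge0 _).
by move=> ->; eexists.
Qed.

Lemma sqr_norm_le_sum (R : realType) (N : nat) (p : 'rV[R]_N.+1) :
  `|p| ^+ 2 <= \sum_k p ord0 k ^+ 2.
Proof.
have [k ->] := norm_coord_eq p.
rewrite (bigD1 k)//= real_normK ?num_real// lerDl sumr_ge0// => j _.
exact: sqr_ge0.
Qed.

Lemma compact_norm_le (R : realType) (N : nat) (r : R) :
  compact [set z : 'rV[R]_N.+1 | `|z| <= r].
Proof.
apply: bounded_closed_compact.
  exists r; split; first exact: num_real.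
  by move=> M rM z /= zr; rewrite (le_trans zr)// ltW.
rewrite (_ : [set z | _] = (fun z : 'rV[R]_N.+1 => `|z|) @^-1` [set x | x <= r])//.
by apply: preimage_closed; [move=> z _; exact: norm_continuous|exact: closed_le].
Qed.

Lemma exists_small_expr (R : realType) (x e A : R) : 0 <= x -> x < 1 -> 0 <= A ->
  0 < e -> exists n, A * x ^+ n < e.
Proof.
move=> x0 x1 A0 e0; have A1 : 0 < A + 1 by rewrite ltr_wpDl.
have x1' : `|x| < 1 by rewrite ger0_norm.
have /cvgrPdist_lt/(_ (e / (A + 1))) := cvg_expr x1'.
rewrite divr_gt0// => /(_ isT)[n _ /(_ n (leqnn n))] /=.
rewrite sub0r normrN ger0_norm ?exprn_ge0// => xe; exists n.
have xn0 : 0 <= x ^+ n by rewrite exprn_ge0.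
move: xe; rewrite ltr_pdivlMr// => xe; nra.
Qed.

Section subsolution_segment.
Context {R : realType} {N : nat}.
Notation V := 'rV[R]_N.+1.
Variables (h : V -> V -> R) (b U : R -> V -> R) (S Lam s t t' rho M0 : R) (y q : V).
Hypothesis Usub : forall (phi : R * V -> R) (r : R) (z : V),
  C1_on [set z : R * V | 0 < z.1] phi -> 0 < r ->
  (\forall z' \near (r, z), U z'.1 z'.2 - phi z' <= U r z - phi (r, z)) ->
  time_deriv phi (r, z) + h z (space_grad phi (r, z)) + b r z <= 0.
Hypothesis Lam0 : 0 <= Lam.
Hypothesis Ulip : forall r r' z z', 0 <= r <= S -> 0 <= r' <= S ->
  `|U r z - U r' z'| <= Lam * (`|r - r'| + `|z - z'|).
Hypotheses (s0 : 0 <= s) (st : s < t) (tt' : t < t') (t'S : t' <= S).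
Hypothesis rho0 : 0 < rho.
Hypothesis tubeM0 : forall r z p, s <= r <= t' -> `|z - y - (r - s) *: q| <= rho ->
  dotv p q - h z p - b r z <= M0.

(* [U] is controlled on [0, S] only; clamping the time makes it globally continuous. *)
Let cl r := Num.max 0 (Num.min S r).

Let S0 : 0 <= S.
Proof. by apply: le_trans t'S; rewrite ltW// (le_lt_trans s0)// (lt_trans st). Qed.

Let clS r : 0 <= cl r <= S.
Proof. by rewrite /cl le_max lexx/= ge_max S0 ge_min lexx. Qed.

Let cl_id r : 0 <= r <= S -> cl r = r.
Proof. by move=> /andP[r0 rS]; rewrite /cl min_r// max_r. Qed.

Let cl_lip r r' : `|cl r - cl r'| <= `|r - r'|.
Proof.
wlog rr' : r r' / r' <= r.
  move=> wl; have [/wl//|/ltW/wl] := leP r' r.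
  by rewrite distrC [in leRHS]distrC.
rewrite [leRHS]ger0_norm ?subr_ge0// ler_norml /cl.
case: (leP S r) => ?; case: (leP S r') => ?;
case: (leP 0 S) => ?; case: (leP 0 r) => ?; case: (leP 0 r') => ?;
by apply/andP; split; lra.
Qed.

Let G (z : R * V) : R := U (cl z.1) z.2.

Let G_continuous : continuous G.
Proof.
move=> z; apply/cvgrPdist_le => e e0.
near=> z'; rewrite /G; apply: (le_trans (Ulip _ _ (clS _) (clS _))).
have zz' : `|z - z'| <= e / (2 * (Lam + 1)).
  near: z'; apply: cvgr_dist_le; first exact: cvg_id.
  by rewrite divr_gt0// mulr_gt0// ltr_wpDl.
have h1 : `|z.1 - z'.1| <= `|z - z'| by rewrite [leRHS]prod_normE le_max lexx.
have h2 : `|z.2 - z'.2| <= `|z - z'| by rewrite [leRHS]prod_normE le_max lexx orbT.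
have h3 := cl_lip z.1 z'.1.
apply: (@le_trans _ _ (Lam * (2 * (e / (2 * (Lam + 1)))))).
  by rewrite ler_wpM2l//; lra.
have Lam1 : 0 < Lam + 1 by rewrite ltr_wpDl.
have -> : Lam * (2 * (e / (2 * (Lam + 1)))) = (Lam * e) / (Lam + 1).
  by field; rewrite gt_eqF.
by rewrite ler_pdivrMr//; nra.
Unshelve. all: by end_near. Qed.

(* [U - tube_test] is larger at the end [t] of the segment than at time [s], time [t'] and
   on the boundary of the tube, so its maximum over the tube is a local one; there the
   subsolution inequality contradicts [tubeM0]. *)
Lemma subsolution_segment : U t (y + (t - s) *: q) - U s y <= M0 * (t - s).
Proof.
rewrite leNgt; apply/negP => gap0.
have ts0 : 0 < t - s by rewrite subr_gt0.
(* Half of the excess is spent on making [M] strictly larger than [M0]; the other half, [g], remains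
   available to localize the maximum. *)
pose g := (U t (y + (t - s) *: q) - U s y - M0 * (t - s)) / 2.
have g0 : 0 < g by rewrite /g divr_gt0// subr_gt0.
pose M := M0 + g / (t - s).
have MM0 : M0 < M by rewrite /M ltrDl divr_gt0.
have gE : U t (y + (t - s) *: q) - U s y - M * (t - s) = g.
  by rewrite /M mulrDl divfK ?gt_eqF// /g; field.
pose th := t' - s.
have th0 : 0 < th by rewrite /th subr_gt0 (lt_trans st).
(* [A] bounds the growth of [U] minus the linear term of the test function over the whole tube, as
   [bigA] checks. At time [t'] the power term equals [A] and cancels it. *)
have [A AE] : exists A, A = Lam * (th + (rho + th * `|q|)) + `|M| * th by eexists.
have A0 : 0 <= A.
  rewrite AE; have h1 := ltW th0; have h2 := mulr_ge0 h1 (normr_ge0 q).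
  apply: addr_ge0 (mulr_ge0 Lam0 _) (mulr_ge0 (normr_ge0 _) h1).
  exact: addr_ge0 h1 (addr_ge0 (ltW rho0) h2).
have [n nA] : exists n, A * ((t - s) / th) ^+ n < g / 2.
  apply: exists_small_expr => //; last by rewrite divr_gt0.
    by rewrite divr_ge0// ltW.
  by rewrite ltr_pdivrMr// mul1r /th ltrD2r.
(* [A / rho ^+ 2] rules out the lateral boundary. [Lam ^+ 2 / g] rules out the initial time, where
   Young's inequality leaves at most [g / 4], whereas the maximum exceeds [U s y] by more than
   [g / 2]. *)
pose K := Lam ^+ 2 / g + A / rho ^+ 2 + 1.
have K0 : 0 <= K.
  by rewrite /K !addr_ge0// divr_ge0// ?sqr_ge0// ltW.
pose phi := tube_test y q s th M A K n.
(* Straightens the tube into a product of an interval and a ball, which is compact. *)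
pose psi (c : R * V) : R * V := (c.1, y + (c.1 - s) *: q + c.2).
pose f c := G (psi c) - phi (psi c).
have phi_C1 := C1_with_tube_test y q s th M A K n.
have scale_cont : continuous (fun z : R * V => (z.1 - s) *: q).
  move=> z; apply: (@cvgZr_tmp _ _ _ _ _ (fun z : R * V => z.1 - s)).
  by apply: cvgB; [exact: cvg_fst|exact: cvg_cst].
have psi_cont : continuous psi.
  move=> z; have c2 : (y + (c.1 - s) *: q + c.2) @[c --> z] -->
      y + (z.1 - s) *: q + z.2.
    apply: cvgD; last exact: cvg_snd.
    by apply: cvgD; [exact: cvg_cst|exact: scale_cont].
  by have := cvg_pair (cvg_fst : c.1 @[c --> z] --> z.1) c2; apply.
have gap_cont : continuous (tube_gap y q s).
  move=> z; apply: cvgB; last exact: scale_cont.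
  by apply: cvgB; [exact: cvg_snd|exact: cvg_cst].
have f_cont : continuous f.
  move=> c; apply: cvgB; apply: (@continuous_comp _ _ _ psi).
  - exact: psi_cont.
  - exact: G_continuous.
  - exact: psi_cont.
  - by apply: differentiable_continuous; case: phi_C1.
pose D : set (R * V) := `[s, t']%classic `*` [set z | `|z| <= rho].
have cD : compact D.
  by apply: compact_setX; [exact: segment_compact|exact: compact_norm_le].
have tD : D (t, 0).
  split; first by rewrite /= in_itv/= !ltW.
  by rewrite /= normr0 ltW.
have [||c cinD cmax] := @compact_EVT_max _ _ f D _ cD _.
- by exists (t, 0).
- exact: continuous_subspaceT.
have {cinD} [cs cr] : D c by exact: set_mem.
have gapE c' : tube_gap y q s (psi c') = c'.2.
  by rewrite /tube_gap /psi /= -addrA -opprD [X in X - _]addrC addrK.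
have fE c' : D c' -> f c' = U c'.1 (psi c').2 - (M * (c'.1 - s) +
    A * ((c'.1 - s) / th) ^+ n + K * \sum_k c'.2 ord0 k ^+ 2).
  move=> [/=]; rewrite in_itv/= => /andP[sc ct] _.
  rewrite /f /G /phi /tube_test gapE /= cl_id//.
  by rewrite (le_trans s0 sc) (le_trans ct t'S).
have fU c' : D c' -> f c' - U s y <= Lam * ((c'.1 - s) + ((c'.1 - s) * `|q| + `|c'.2|)) -
    M * (c'.1 - s) - A * ((c'.1 - s) / th) ^+ n - K * `|c'.2| ^+ 2.
  move=> Dc'; rewrite fE//; move: Dc' => [/=]; rewrite in_itv/= => /andP[sc ct] _.
  have cs0 : 0 <= c'.1 - s by rewrite subr_ge0.
  have := @Ulip c'.1 s (psi c').2 y.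
  rewrite (le_trans s0 sc) (le_trans ct t'S) s0 (le_trans (ltW (lt_trans st tt')) t'S).
  move=> /(_ isT isT) Ul.
  have psiy : `|(psi c').2 - y| <= (c'.1 - s) * `|q| + `|c'.2|.
    rewrite /psi /= -(addrA y) [X in `|X|]addrC addKr (le_trans (ler_normD _ _))//.
    by rewrite normrZ ger0_norm.
  have /(le_trans (ler_norm _)) := Ul; rewrite (ger0_norm cs0) => Ul'.
  have := ler_wpM2l Lam0 psiy.
  have := ler_wpM2l K0 (sqr_norm_le_sum c'.2).
  by rewrite !mulrDr in Ul' *; lra.
have ft : U s y + g / 2 < f c.
  apply: lt_le_trans (cmax (t, 0) _); last by rewrite inE.
  rewrite fE//= addr0 big1; last by move=> k _; rewrite mxE expr0n.
  by lra.
have gap_c1 : 0 <= c.1 - s by move: cs; rewrite /= in_itv/= subr_ge0 => /andP[].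
have gap_c2 : c.1 - s <= th.
  by move: cs; rewrite /= in_itv/= /th lerD2r => /andP[].
have pow0 : 0 <= A * ((c.1 - s) / th) ^+ n.
  by rewrite mulr_ge0// exprn_ge0// divr_ge0// ltW.
have fUc := fU c (conj cs cr).
have bigA : Lam * ((c.1 - s) + ((c.1 - s) * `|q| + `|c.2|)) - M * (c.1 - s) <= A.
  have q0 := normr_ge0 q.
  have : (c.1 - s) * `|q| <= th * `|q| by rewrite ler_wpM2r.
  move=> cq; have : (c.1 - s) + ((c.1 - s) * `|q| + `|c.2|) <= th + (rho + th * `|q|).
    by move: cr => /= cr; lra.
  move=> /(ler_wpM2l Lam0) h1.
  have h2 : - M * (c.1 - s) <= `|M| * th.
    apply: (@le_trans _ _ (`|M| * (c.1 - s))).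
      by rewrite ler_wpM2r// -normrN ler_norm.
    by rewrite ler_wpM2l.
  by rewrite AE; lra.
have c2 : `|c.2| < rho.
  rewrite lt_neqAle cr andbT; apply/eqP => c2rho.
  have : A <= K * `|c.2| ^+ 2.
    have eA : A / rho ^+ 2 * rho ^+ 2 = A by rewrite divfK// gt_eqF// exprn_gt0.
    rewrite c2rho /K !mulrDl eA.
    have : 0 <= Lam ^+ 2 / g * rho ^+ 2.
      by apply: mulr_ge0 (sqr_ge0 _); apply: divr_ge0 (sqr_ge0 _) (ltW g0).
    by have := sqr_ge0 rho; lra.
  by lra.
have cs' : s < c.1.
  rewrite -subr_gt0 lt_neqAle gap_c1 andbT; apply/eqP => c1s.
  have : Lam * `|c.2| <= Lam ^+ 2 / g * `|c.2| ^+ 2 + g / 4.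
    rewrite mulrAC -exprMn; set w := Lam * _.
    have -> : w ^+ 2 / g + g / 4 = w + (w - g / 2) ^+ 2 / g by field; rewrite gt_eqF.
    by rewrite lerDl divr_ge0 ?sqr_ge0// ltW.
  have : Lam ^+ 2 / g * `|c.2| ^+ 2 <= K * `|c.2| ^+ 2.
    rewrite ler_wpM2r ?sqr_ge0// /K -addrA lerDl addr_ge0//.
    by rewrite divr_ge0 ?sqr_ge0.
  by move: fUc pow0; rewrite -c1s; lra.
have ct' : c.1 < t'.
  rewrite -(ltrD2r (- s)) lt_neqAle gap_c2 andbT; apply/eqP => c1t.
  have := fUc; rewrite c1t divff ?gt_eqF// expr1n mulr1 -/th.
  have : 0 <= K * `|c.2| ^+ 2 by rewrite mulr_ge0// sqr_ge0.
  by rewrite c1t -/th in bigA; lra.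
have r0 : 0 < c.1 by exact: le_lt_trans s0 cs'.
have psic : psi c = (c.1, (psi c).2) by [].
have phi_C1on := C1_withP (A := [set z : R * V | 0 < z.1]) phi_C1.
have touch : \forall z' \near (c.1, (psi c).2),
    U z'.1 z'.2 - phi z' <= U c.1 (psi c).2 - phi (c.1, (psi c).2).
  near=> z'.
  have z1 : s < z'.1 by near: z'; apply: (cvgr_gt _ (@cvg_fst _ _ _ _ _)).
  have z2 : z'.1 < t' by near: z'; apply: (cvgr_lt _ (@cvg_fst _ _ _ _ _)).
  have z3 : `|tube_gap y q s z'| < rho.
    near: z'; apply: (cvgr_norm_lt _ (gap_cont _)).
    by rewrite -psic gapE.
  have Dz' : D (z'.1, tube_gap y q s z').
    by split; rewrite /= ?in_itv/= ltW ?(ltW z2).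
  have psiz' : psi (z'.1, tube_gap y q s z') = z'.
    rewrite /psi /tube_gap /= [in RHS](surjective_pairing z'); congr pair.
    by rewrite -(addrA z'.2) -opprD addrCA subrr addr0.
  have := cmax _ (mem_set Dz'); rewrite /f psiz' /G.
  rewrite (cl_id (r := z'.1)); last first.
    by rewrite (le_trans s0 (ltW z1)) (le_trans (ltW z2) t'S).
  rewrite (cl_id (r := (psi c).1)) -?psic//.
  by rewrite /= (le_trans s0 (ltW cs')) (le_trans (ltW ct') t'S).
(* The power term has a nonnegative time derivative, so the inequality gives
   [M <= dotv p q - h z p - b r z <= M0], against [MM0]. *)
have := Usub phi_C1on r0 touch.
rewrite -psic /phi tube_test_time tube_test_grad; set p := \row_k _.
have := @tubeM0 c.1 (psi c).2 p.
rewrite (ltW cs') (ltW ct') -[_ - y - _]/(tube_gap y q s (psi c)) gapE (ltW c2).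
move=> /(_ isT isT).
have : 0 <= A * (n%:R * (((psi c).1 - s) / th) ^+ n.-1 / th).
  rewrite /= mulr_ge0// divr_ge0 ?(ltW th0)// mulr_ge0// exprn_ge0// divr_ge0//.
  exact: ltW.
by lra.
Unshelve. all: by end_near. Qed.

End subsolution_segment.

(** * The Legendre transform of a C^1 function *)

Lemma sum_continuous (R : realType) (X : topologicalType) (n : nat)
    (f : 'I_n -> X -> R) :
  (forall k, continuous (f k)) -> continuous (fun x => \sum_(k < n) f k x).
Proof.
move=> fc; rewrite /index_enum; elim: (Finite.enum _) => [|k s ih] x.
  by under eq_fun do rewrite big_nil; exact: cvg_cst.
by under eq_fun do rewrite big_cons; apply: cvgD; [exact: fc|exact: ih].
Qed.

Section C1_product.
Context {R : realType} {N : nat}.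
Notation V := 'rV[R]_N.+1.
Notation W := (V * V)%type.
Variable f : W -> R.
Hypothesis f_C1 : C1_on setT f.

Let df (y v : W) : R := 'd f y v.

Lemma is_derive_line (a v : W) (t : R) :
  is_derive t 1 (fun t => f (a + t *: v)) (df (a + t *: v) v).
Proof.
rewrite /df; have [fd _] := f_C1 (z := a + t *: v) I.
have eqf : (fun h : R => h^-1 *: (f (a + (h *: 1 + t) *: v) - f (a + t *: v))) =
    (fun h => h^-1 *: (f (h *: v + (a + t *: v)) - f (a + t *: v))).
  apply/funext => h; congr (_ *: (f _ - _)).
  by rewrite [h *: 1]mulr1 scalerDl addrCA.
have dv := diff_derivable (v := v) fd.
split.
  by rewrite /derivable eqf.
by rewrite /derive eqf -(deriveE v fd).
Qed.

Lemma diff_expand (y v : W) : df y v =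
  \sum_k v.1 ord0 k * df y (delta_mx 0 k, 0) +
  \sum_k v.2 ord0 k * df y (0, delta_mx 0 k).
Proof.
have e1 (w : V) : (w, 0 : V) = \sum_k w ord0 k *: (delta_mx 0 k, 0 : V).
  rewrite {1}(row_sum_delta w) (big_morph (fun x : V => (x, 0 : V))
    (id1 := 0) (op1 := +%R))//; first by apply: eq_bigr => k _; congr pair; rewrite scaler0.
  by move=> p q; congr pair; rewrite addr0.
have e2 (w : V) : (0 : V, w) = \sum_k w ord0 k *: (0 : V, delta_mx 0 k).
  rewrite {1}(row_sum_delta w) (big_morph (fun x : V => (0 : V, x))
    (id1 := 0) (op1 := +%R))//; first by apply: eq_bigr => k _; congr pair; rewrite scaler0.
  by move=> p q; congr pair; rewrite addr0.
have vE : v = (v.1, 0) + (0, v.2).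
  by case: v => v1 v2; congr pair; rewrite /= ?addr0 ?add0r.
rewrite /df {1}vE e1 e2 raddfD !raddf_sum.
by congr (_ + _); apply: eq_bigr => k _; exact: linearZ.
Qed.

(** [C1_on] gives continuity in the base point for each fixed direction; expanding the direction in
    the standard basis makes it joint, as compactness in both arguments requires. *)
Lemma diff_joint_continuous : continuous (fun c : W * W => df c.1 c.2).
Proof.
have -> : (fun c : W * W => df c.1 c.2) = (fun c : W * W =>
  \sum_k c.2.1 ord0 k * df c.1 (delta_mx 0 k, 0) +
  \sum_k c.2.2 ord0 k * df c.1 (0, delta_mx 0 k)).
  by apply/funext => c; rewrite diff_expand.
have dc (e : W) : continuous (fun c : W * W => df c.1 e).
  move=> c; apply: (@continuous_comp _ _ _ fst (fun y : W => df y e)).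
    exact: cvg_fst.
  by have [_] := f_C1 (z := c.1) I; exact.
move=> c; apply: cvgD; apply: sum_continuous => k {}c; apply: cvgM; try exact: dc.
- apply: (@continuous_comp _ _ _ (fun c : W * W => c.2.1) (fun m : V => m ord0 k)).
    by apply: (@continuous_comp _ _ _ snd (@fst V V)); [exact: cvg_snd|exact: cvg_fst].
  exact: coord_continuous.
- apply: (@continuous_comp _ _ _ (fun c : W * W => c.2.2) (fun m : V => m ord0 k)).
    by apply: (@continuous_comp _ _ _ snd (@snd V V)); [exact: cvg_snd|exact: cvg_snd].
  exact: coord_continuous.
Qed.

Lemma compact_norm_le_pair (r : R) : compact [set z : W | `|z| <= r].
Proof.
rewrite (_ : [set z : W | _] =
  [set z : V | `|z| <= r] `*` [set z : V | `|z| <= r]).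
  by apply: compact_setX; exact: compact_norm_le.
by apply/seteqP; split => z /=; rewrite prod_normE ge_max => /andP.
Qed.

Lemma MVT_line (a v : W) (t : R) : 0 < t -> exists2 s, 0 < s < t &
  f (a + t *: v) - f a = t * df (a + s *: v) v.
Proof.
move=> t0.
have [|s] := @MVT R (fun t => f (a + t *: v)) (fun t => df (a + t *: v) v) 0 t t0
  (fun x _ => is_derive_line a v x).
  apply: derivable_within_continuous => x _.
  by have [] := is_derive_line a v x.
rewrite in_itv/= scale0r addr0 subr0 => st ->.
by exists s => //; rewrite mulrC.
Qed.

Lemma C1_lipschitz_ball (r : R) : exists2 C, 0 <= C &
  forall z z', `|z| <= r -> `|z'| <= r -> `|f z - f z'| <= C * `|z - z'|.
Proof.
have cK : compact ([set z : W | `|z| <= r] `*` [set z : W | `|z| <= 1]).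
  by apply: compact_setX; exact: compact_norm_le_pair.
have [M [Mreal MK]] : bounded_set [set df c.1 c.2 | c in
    [set z : W | `|z| <= r] `*` [set z : W | `|z| <= 1]].
  apply: compact_bounded; apply: continuous_compact => //.
  exact: continuous_subspaceT diff_joint_continuous.
pose C := `|M| + 1.
have MC : M < C by rewrite /C (le_lt_trans (ler_norm _))// ltrDl.
have dC y v : `|y| <= r -> `|v| <= 1 -> `|df y v| <= C.
  by move=> yr v1; apply: (MK _ MC); exists (y, v).
exists C => [|z z' zr z'r]; first by rewrite /C addr_ge0.
have [->|zz'] := eqVneq z z'; first by rewrite !subrr !normr0 mulr0.
have n0 : 0 < `|z - z'| by rewrite normr_gt0 subr_eq0.
pose v := `|z - z'|^-1 *: (z - z').
have v1 : `|v| = 1 by rewrite /v normrZ normfV normr_id mulVf// gt_eqF.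
have vz : z' + `|z - z'| *: v = z.
  by rewrite /v scalerA divff ?gt_eqF// scale1r addrC subrK.
have [s /andP[s0 s1]] := MVT_line z' v n0; rewrite vz => ->.
rewrite normrM normr_id mulrC ler_wpM2r// dC ?v1//.
have l0 : 0 <= s / `|z - z'| by rewrite divr_ge0// ltW.
have l1 : s / `|z - z'| <= 1 by rewrite ler_pdivrMr// mul1r ltW.
rewrite /v scalerA; move: (s / _) l0 l1 => l l0 l1.
have -> : z' + l *: (z - z') = (1 - l) *: z' + l *: z.
  by rewrite scalerBr scalerBl scale1r addrA addrAC.
rewrite (le_trans (ler_normD _ _))// !normrZ !ger0_norm ?subr_ge0//.
have -> : r = (1 - l) * r + l * r by ring.
by rewrite lerD// ler_wpM2l// subr_ge0.
Qed.

(** By the mean value theorem the second difference is [t] times the variation of the differential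
    between two points that merge as [t] tends to [0]; joint continuity makes this small uniformly
    on compact sets. *)
Lemma C1_second_difference (r e : R) : 0 < e -> exists2 t, 0 < t &
  forall z w, `|z| <= r -> `|w| <= r ->
    f (z + t *: w) + f (z - t *: w) - 2 * f z <= t * e.
Proof.
move=> e0.
have cK : compact ([set z : W | `|z| <= r] `*` [set z : W | `|z| <= r]).
  by apply: compact_setX; exact: compact_norm_le_pair.
pose g (t : R) (c : W * W) :=
  df (c.1 + t *: c.2) c.2 - df (c.1 - t *: c.2) c.2.
have : \forall t \near (0 : R), [set z : W | `|z| <= r] `*`
    [set z : W | `|z| <= r] `<=` [set c | g t c < e].
  (* The covering form of compactness yields one neighbourhood of [0] valid for all [c]. *)
  have /compact_near_coveringP nc := cK.
  apply: (nc _ (nbhs (0 : R)) (fun t c => g t c < e)) => c _.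
  pose sg (s : R) (z : W * W * R) : W := z.1.1 + (s * z.2) *: z.1.2.
  have sg_cont s : continuous (sg s).
    move=> z; apply: cvgD.
      by apply: (@continuous_comp _ _ _ fst (@fst W W)); exact: cvg_fst.
    apply: cvgZ.
      by apply: cvgM; [exact: cvg_cst|exact: cvg_snd].
    by apply: (@continuous_comp _ _ _ fst (@snd W W)); [exact: cvg_fst|exact: cvg_snd].
  have dfc s : continuous (fun z : W * W * R => df (sg s z) z.1.2).
    move=> z; have snd_cont : z'.1.2 @[z' --> z] --> z.1.2.
      by apply: (@continuous_comp _ _ _ fst (@snd W W)); [exact: cvg_fst|exact: cvg_snd].
    have pc : (sg s z', z'.1.2) @[z' --> z] --> (sg s z, z.1.2).
      by have := cvg_pair (sg_cont s z) snd_cont; apply.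
    apply: (@continuous_comp _ _ _ (fun z' : W * W * R => (sg s z', z'.1.2))
      (fun c : W * W => df c.1 c.2)) => //.
    exact: diff_joint_continuous.
  have gc : (df (sg 1 z) z.1.2 - df (sg (-1) z) z.1.2) @[z --> (c, 0 : R)] -->
      df (sg 1 (c, 0)) c.2 - df (sg (-1) (c, 0)) c.2.
    by apply: cvgB; exact: dfc.
  have : \forall z \near (c, 0 : R), df (sg 1 z) z.1.2 - df (sg (-1) z) z.1.2 < e.
    by apply: (cvgr_lt _ gc); rewrite /sg /= !mulr0 scale0r subrr.
  apply: filterS => z; rewrite /sg /g mul1r mulN1r scaleNr.
  exact.
move=> /nbhs_ballP[d /= d0 dg].
have t0 : 0 < d / 2 by rewrite divr_gt0.
exists (d / 2) => // z w zr wr.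
have dphi (x : R) : is_derive x 1 ((fun t => f (z + t *: w)) + (fun t => f (z + t *: - w)))
    (g x (z, w)).
  have -> : g x (z, w) = df (z + x *: w) w + df (z + x *: - w) (- w).
    have -> y : df y (- w) = - df y w by exact: (raddfN ('d f y)).
    by rewrite (scalerN x w).
  by apply: is_deriveD; exact: is_derive_line.
have [|s] := MVT t0 (fun x _ => dphi x).
  by apply: derivable_within_continuous => x _; have [] := dphi x.
rewrite in_itv/= => /andP[s0 st].
rewrite -[LHS]/(f (z + (d / 2) *: w) + f (z + (d / 2) *: - w) -
  (f (z + 0 *: w) + f (z + 0 *: - w))) !scale0r addr0 scalerN subr0.
have gs : g s (z, w) < e.
  apply: (dg s _ (z, w)) => //; rewrite /ball/= sub0r normrN gtr0_norm//.
  by rewrite (lt_trans st)// ltr_pdivrMr// ltr_pMr// ltr1n.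
move=> eqf; have : g s (z, w) * (d / 2) <= e * (d / 2) by rewrite ler_wpM2r// ltW.
by rewrite -eqf; lra.
Qed.

End C1_product.

Section dotv.
Context {R : realType} {N : nat}.
Implicit Types p q : 'rV[R]_N.

Lemma dotvDl p1 p2 q : dotv (p1 + p2) q = dotv p1 q + dotv p2 q.
Proof. by rewrite /dotv -big_split; apply: eq_bigr => k _; rewrite mxE mulrDl. Qed.

Lemma dotvZl t p q : dotv (t *: p) q = t * dotv p q.
Proof. by rewrite /dotv mulr_sumr; apply: eq_bigr => k _; rewrite mxE mulrA. Qed.

Lemma dotvC p q : dotv p q = dotv q p.
Proof. by apply: eq_bigr => k _; rewrite mulrC. Qed.

Lemma dotvNl p q : dotv (- p) q = - dotv p q.
Proof. by rewrite -scaleN1r dotvZl mulN1r. Qed.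

Lemma dotvDr p q1 q2 : dotv p (q1 + q2) = dotv p q1 + dotv p q2.
Proof. by rewrite dotvC dotvDl !(dotvC _ p). Qed.

Lemma dotvZr t p q : dotv p (t *: q) = t * dotv p q.
Proof. by rewrite dotvC dotvZl dotvC. Qed.

Lemma dotvNr p q : dotv p (- q) = - dotv p q.
Proof. by rewrite dotvC dotvNl dotvC. Qed.

Lemma dotv0l q : dotv 0 q = 0.
Proof. by rewrite -(scale0r 0) dotvZl mul0r. Qed.

End dotv.

Lemma dotv_le (R : realType) (N : nat) (p q : 'rV[R]_N.+1) :
  dotv p q <= N.+1%:R * (enorm p * `|q|).
Proof.
rewrite /dotv; have -> : N.+1%:R * (enorm p * `|q|) =
    \sum_(k < N.+1) (enorm p * `|q|).
  by rewrite sumr_const card_ord mulr_natl.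
apply: ler_sum => k _; rewrite (le_trans (ler_norm _))// normrM.
by rewrite ler_pM// ?coord_le_enorm// norm_coord_le.
Qed.

Lemma norm_le_enorm (R : realType) (N : nat) (p : 'rV[R]_N.+1) :
  `|p| <= enorm p.
Proof. by have [k ->] := norm_coord_eq p; exact: coord_le_enorm. Qed.

Section lagrangian.
Context {R : realType} {N : nat}.
Notation V := 'rV[R]_N.+1.
Variables (h : V -> V -> R) (al be : R -> R).
Hypothesis h_C1 : C1_on setT (fun z : V * V => h z.1 z.2).
Hypothesis al_superlinear : superlinear al.
Hypothesis h_bound : forall x p, al (enorm p) <= h x p <= be (enorm p).

Let L (x q : V) : R := sup (range (fun p => dotv p q - h x p)).

Lemma legendre_coercive (Q : R) : exists2 P, 0 <= P & forall x q p,
  `|q| <= Q -> P <= `|p| -> dotv p q - h x p <= - h x 0.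
Proof.
(* The factor [N.+1] compares [dotv] with the max norm. The extra [1] leaves a surplus [enorm p],
   which dominates [be 0] and hence [h x 0]. *)
have [r [_ alr]] := (cvgryPge _).1 al_superlinear (N.+1%:R * `|Q| + 1).
pose P := `|r| + 1 + `|be 0|.
exists P; first by rewrite /P addr_ge0// addr_ge0.
move=> x q p qQ Pp.
have Pe : P <= enorm p := le_trans Pp (norm_le_enorm p).
have re : r < enorm p.
  apply: lt_le_trans Pe; rewrite /P -addrA.
  by rewrite (le_lt_trans (ler_norm _))// ltrDl ltr_pwDl.
have e1 : 1 <= enorm p.
  by apply: le_trans Pe; rewrite /P addrAC lerDr addr_ge0.
have be0 : `|be 0| <= enorm p.
  by apply: le_trans Pe; rewrite /P lerDr addr_ge0.
have e0 : 0 < enorm p by exact: lt_le_trans e1.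
have := alr _ re; rewrite ler_pdivlMr// => al1.
have /andP[h1 _] := h_bound x p.
have /andP[_] := h_bound x 0.
have -> : enorm (0 : V) = 0 by rewrite /enorm dotv0l sqrtr0.
have := ler_norm (be 0); have d := dotv_le p q.
have : N.+1%:R * (enorm p * `|q|) <= N.+1%:R * `|Q| * enorm p.
  rewrite -mulrA ler_wpM2l// mulrC ler_wpM2r ?(ltW e0)//.
  exact: le_trans (ler_norm _).
by lra.
Qed.

Lemma legendre_has_sup (x q : V) : has_sup (range (fun p => dotv p q - h x p)).
Proof.
split; first by eexists; exists 0.
have [P P0 Pc] := legendre_coercive `|q|.
have [C C0 hC] := C1_lipschitz_ball h_C1 (Num.max `|x| P).
exists (Num.max (- h x 0) (\sum_(k < N.+1) P * `|q| + C * P - h x 0)).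
move=> _ [p _ <-]; rewrite le_max; apply/orP.
have [pP|/ltW pP] := leP P `|p|; [left; exact: Pc|right].
have : `|h x 0 - h x p| <= C * P.
  have := hC (x, 0) (x, p); rewrite !prod_normE /= !subrr !normr0 sub0r normrN.
  rewrite !ge_max !le_max lexx P0 pP normr_ge0 !orbT/= => /(_ isT isT).
  rewrite max_r// => /le_trans; apply; exact: ler_wpM2l.
move=> /(le_trans (ler_norm _)) hp.
have : dotv p q <= \sum_(k < N.+1) P * `|q|.
  apply: ler_sum => k _; rewrite (le_trans (ler_norm _))// normrM.
  by rewrite ler_pM// ?norm_coord_le// (le_trans (norm_coord_le _ _)).
by lra.
Qed.

Lemma legendre_ge (x q p : V) : dotv p q - h x p <= L x q.
Proof. by apply: ub_le_sup; [exact: (legendre_has_sup x q).2|exists p]. Qed.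

(** Outside a ball that does not depend on [x], every [p] does no better than [p = 0]; so the
    supremum may be tested on that ball, where [h] has uniform bounds. *)
Lemma legendre_le (Q : R) : exists2 P, 0 <= P & forall x q M, `|q| <= Q ->
  (forall p, `|p| <= P -> dotv p q - h x p <= M) -> L x q <= M.
Proof.
have [P P0 Pc] := legendre_coercive Q; exists P => // x q M qQ pM.
apply: ge_sup; first by eexists; exists 0.
move=> _ [p _ <-]; have [pP|/ltW pP] := leP `|p| P; first exact: pM.
apply: le_trans (Pc x q p qQ pP) _.
by have := pM 0; rewrite normr0 dotv0l sub0r; apply.
Qed.

Lemma legendre_lipschitz (X Q : R) : exists2 C, 0 <= C & forall x x' q,
  `|x| <= X -> `|x'| <= X -> `|q| <= Q -> L x q - L x' q <= C * `|x - x'|.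
Proof.
have [P P0 PL] := legendre_le Q.
have [C C0 hC] := C1_lipschitz_ball h_C1 (Num.max X P).
exists C => // x x' q xX x'X qQ.
rewrite lerBlDl; apply: (PL) => // p pP.
have := hC (x', p) (x, p); rewrite !prod_normE /= !subrr !normr0.
rewrite !ge_max !le_max xX x'X pP !orbT/= => /(_ isT isT).
rewrite max_l// => /(le_trans (ler_norm _)); rewrite distrC.
by have := legendre_ge x' q p; lra.
Qed.

(* The affine minorants of [L] with slopes [p + t (q - q')] at [q] and [p - t (q - q')] at
   [q'] gain [t |q - q'|^2] over those of slope [p], while being C^1, [h] loses [o(t)]. *)
Lemma legendre_uniformly_convex (X Q e : R) : 0 < e -> exists2 k, 0 < k &
  forall x q q', `|x| <= X -> `|q| <= Q -> `|q'| <= Q -> e <= `|q - q'| ->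
  k + 2 * L x (2^-1 *: (q + q')) <= L x q + L x q'.
Proof.
move=> e0; have [P P0 PL] := legendre_le Q.
(* The minorants gain at least [t * e ^+ 2]; allowing [h] to lose half of it leaves the other half
   as modulus of convexity. *)
have e20 : 0 < e ^+ 2 / 2 by rewrite divr_gt0// exprn_gt0.
have [t t0 ht] := C1_second_difference h_C1 (Num.max X (Num.max P (2 * Q))) e20.
exists (t * (e ^+ 2 / 2)); first by rewrite mulr_gt0.
move=> x q q' xX qQ q'Q eqq'.
suff : L x (2^-1 *: (q + q')) <= (L x q + L x q' - t * (e ^+ 2 / 2)) / 2 by lra.
apply: PL => [|p pP].
  rewrite normrZ ger0_norm// (le_trans (ler_wpM2l _ (ler_normD _ _)))//.
  by rewrite mulrC ler_pdivrMr//; lra.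
have ww : e ^+ 2 <= dotv (q - q') (q - q').
  apply: (@le_trans _ _ (`|q - q'| ^+ 2)).
    by rewrite ler_pXn2r// ?nnegrE ?(ltW e0)// (le_trans (ltW e0)).
  apply: le_trans (sqr_norm_le_sum _) _.
  by rewrite /dotv ler_sum// => k _; rewrite expr2.
have := ht (x, p) (0, q - q').
rewrite !prod_normE /= normr0 !ge_max !le_max xX pP P0 !orbT/=.
have -> : `|q - q'| <= 2 * Q.
  by rewrite (le_trans (ler_normB _ _))//; lra.
rewrite !orbT !scaler0 addr0 subr0 => /(_ isT isT) h2.
have := legendre_ge x q (p + t *: (q - q')).
have := legendre_ge x q' (p - t *: (q - q')).
have tw : t * e ^+ 2 <= t * dotv (q - q') (q - q') by rewrite ler_pM2l.
move: h2 tw; rewrite !(dotvDl, dotvNl, dotvZl, dotvDr, dotvNr, dotvZr).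
set a1 := h _ _; set a2 := h _ _; set a3 := h _ _.
by lra.
Qed.

End lagrangian.

(** * Regularity of calibrated curves *)

Section calibrated_curve.
Context {R : realType} {V : normedModType R}.
Variables (U b : R -> V -> R) (L : V -> V -> R) (c : R -> V) (t1 t2 X Lam C : R).
Hypothesis C0 : 0 <= C.
Hypothesis Lam0 : 0 <= Lam.
Hypothesis c_lip : forall s t, t1 <= s -> s <= t -> t <= t2 ->
  `|c t - c s| <= Lam * (t - s).
(** The margin [Lam * (t2 - t1)] keeps the translated pieces in the ball of radius [X] where [L] is
    controlled. *)
Hypothesis c_bound : forall s, t1 <= s -> s <= t2 -> `|c s| + Lam * (t2 - t1) <= X.
Hypothesis c_calibrated : forall s t, t1 <= s -> s < t -> t <= t2 ->
  (t - s) * (L (c s) ((t - s)^-1 *: (c t - c s)) - b s (c s) - C * (t - s)) <=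
  U t (c t) - U s (c s).
Hypothesis U_dominated : forall s t y q, t1 <= s -> s < t -> t <= t2 ->
  `|y| <= X -> `|q| <= Lam ->
  U t (y + (t - s) *: q) - U s y <= (t - s) * (L y q - b s y + C * (t - s)).
Hypothesis L_lip : forall y y' q, `|y| <= X -> `|y'| <= X -> `|q| <= Lam ->
  L y q - L y' q <= C * `|y - y'|.
Hypothesis b_lip : forall s y y', t1 <= s -> s <= t2 ->
  b s y - b s y' <= C * `|y - y'|.
Hypothesis L_convex : forall e, 0 < e -> exists2 k, 0 < k & forall y q q',
  `|y| <= X -> `|q| <= Lam -> `|q'| <= Lam -> e <= `|q - q'| ->
  k + 2 * L y (2^-1 *: (q + q')) <= L y q + L y q'.

Section pieces.
Variables (a eps : R) (n : nat).
Hypotheses (t1a : t1 <= a) (eps0 : 0 < eps) (nt2 : a + n%:R * eps <= t2).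

Let tk (k : nat) := a + k%:R * eps.
Let x k := c (tk k).
Let q k := eps^-1 *: (x k.+1 - x k).

Let tkS k : tk k.+1 - tk k = eps.
Proof. by rewrite /tk -natr1; ring. Qed.

Let tk_lt k : tk k < tk k.+1.
Proof. by rewrite -subr_gt0 tkS. Qed.

Let tk_ge k : t1 <= tk k.
Proof. by rewrite /tk (le_trans t1a)// lerDl mulr_ge0// ltW. Qed.

Let tk_mono k l : (k <= l)%N -> tk k <= tk l.
Proof. by move=> kl; rewrite /tk lerD2l ler_pM2r// ler_nat. Qed.

Let tk_le k : (k <= n)%N -> tk k <= t2.
Proof. by move=> /tk_mono kn; exact: le_trans nt2. Qed.

Let xS k : x k.+1 = x k + eps *: q k.
Proof. by rewrite /q scalerA divff ?gt_eqF// scale1r addrC subrK. Qed.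

Lemma pieces_le k : (k < n)%N -> `|q k| <= Lam.
Proof.
move=> kn; rewrite /q normrZ gtr0_norm ?invr_gt0// mulrC ler_pdivrMr//.
rewrite -[in leRHS](tkS k); apply: c_lip => //; [exact: ltW|exact: tk_le].
Qed.

(* Use the mean slope on the pieces [i] and [l], and translate by [v] the pieces in between:
   the modified curve has the same end points, so domination along it is compared with
   calibration along [c]. [E k] is the gap between both curves at time [tk k]. *)
Lemma pieces_second_difference i l : (i < l)%N -> (l < n)%N ->
  L (x i) (q i) + L (x i) (q l) - 2 * L (x i) (2^-1 *: (q i + q l)) <=
  6 * C * (Lam + 1) * (n%:R * eps).
Proof.
move=> il ln; have iln := ltn_trans il ln.
(* The displacement produced by using [qm] instead of [q i] during a time [eps]; using [qm] instead
   of [q l] later undoes it. *)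
pose v : V := (eps / 2) *: (q l - q i); pose qm := 2^-1 *: (q i + q l).
have t12 : eps <= t2 - t1.
  have : eps <= n%:R * eps by rewrite ler_pMl// ler1n (leq_trans _ ln).
  by move: t1a nt2; lra.
have v_le : `|v| <= Lam * eps.
  have h : `|q l - q i| <= 2 * Lam.
    by have := ler_normB (q l) (q i); have := pieces_le ln; have := pieces_le iln; lra.
  by rewrite /v normrZ gtr0_norm ?divr_gt0//; have := ler_wpM2l (ltW eps0) h; lra.
have qm_le : `|qm| <= Lam.
  rewrite /qm normrZ gtr0_norm// mulrC ler_pdivrMr//.
  by rewrite (le_trans (ler_normD _ _))//; have := pieces_le ln; have := pieces_le iln; lra.
have xX k : (k <= n)%N -> `|x k| <= X.
  move=> kn; apply: le_trans (c_bound (tk_ge k) (tk_le kn)).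
  by rewrite lerDl mulr_ge0//; move: t12 eps0; lra.
have xvX k : (k <= n)%N -> `|x k + v| <= X.
  move=> kn; apply: le_trans (c_bound (tk_ge k) (tk_le kn)).
  rewrite (le_trans (ler_normD _ _))// lerD2l (le_trans v_le)//.
  exact: ler_wpM2l.
pose E k := U (tk k) (x k + v) - U (tk k) (x k).
have cal k : (k < n)%N ->
    eps * (L (x k) (q k) - b (tk k) (x k) - C * eps) <=
    U (tk k.+1) (x k.+1) - U (tk k) (x k).
  move=> kn; have := c_calibrated (tk_ge k) (tk_lt k) (tk_le kn).
  by rewrite tkS.
have dom k y r : (k < n)%N -> `|y| <= X -> `|r| <= Lam ->
    U (tk k.+1) (y + eps *: r) - U (tk k) y <=
    eps * (L y r - b (tk k) y + C * eps).
  move=> kn yX rL; have := U_dominated (tk_ge k) (tk_lt k) (tk_le kn) yX rL.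
  by rewrite tkS.
have bl k : (k <= n)%N -> b (tk k) (x k) - b (tk k) (x k + v) <= C * (Lam * eps).
  move=> kn; apply: (le_trans (b_lip _ _ (tk_ge k) (tk_le kn))).
  by rewrite opprD addNKr normrN ler_wpM2l.
have first_step : E i.+1 <= eps * (L (x i) qm - L (x i) (q i) + 2 * C * eps).
  have := dom i (x i) qm iln (xX i (ltnW iln)) qm_le.
  have -> : x i + eps *: qm = x i.+1 + v.
    rewrite xS -addrA; congr (_ + _); rewrite /v /qm scalerA scalerDr scalerBr.
    by rewrite [X in _ = X *: q i + _](splitr eps) scalerDl addrACA subrr addr0.
  by have := cal i iln; rewrite /E; lra.
(* Translating by [v], of size at most [Lam * eps], costs [O(eps)] per unit of time, thus
   [O(eps ^+ 2)] on one piece. *)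
have middle k : (i < k)%N -> (k < l)%N -> E k.+1 <= E k + eps * (2 * C * (Lam + 1) * eps).
  move=> ik kl; have kn := ltn_trans kl ln.
  have := dom k (x k + v) (q k) kn (xvX k (ltnW kn)) (pieces_le kn).
  have -> : x k + v + eps *: q k = x k.+1 + v by rewrite xS addrAC.
  have := cal k kn; have := ler_wpM2l (ltW eps0) (bl k (ltnW kn)).
  have := L_lip (xvX k (ltnW kn)) (xX k (ltnW kn)) (pieces_le kn).
  rewrite addrAC subrr add0r => h1; have := ler_wpM2l (ltW eps0) (le_trans h1 (ler_wpM2l C0 v_le)).
  by rewrite /E; lra.
have reach k : (i < k)%N -> (k <= l)%N ->
    E k <= E i.+1 + (k - i.+1)%:R * (eps * (2 * C * (Lam + 1) * eps)).
  move=> /subnKC <-; elim: (k - i.+1)%N => [|m ih].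
    by rewrite addn0 subnn mul0r addr0.
  rewrite addnS => ml; have := ih (ltnW ml); rewrite subSn ?leq_addr// addKn.
  have := middle (i.+1 + m)%N (leq_addr _ _) ml; rewrite -natr1; lra.
have last_step : eps * (L (x l) (q l) - L (x l + v) qm - C * (Lam * eps) -
    2 * C * eps) <= E l.
  have := dom l (x l + v) qm ln (xvX l (ltnW ln)) qm_le.
  have -> : x l + v + eps *: qm = x l.+1.
    rewrite xS -addrA; congr (_ + _); rewrite /v /qm scalerA scalerBr scalerDr.
    by rewrite addrA subrK -scalerDl -splitr.
  have := cal l ln; have := ler_wpM2l (ltW eps0) (bl l (ltnW ln)).
  by rewrite /E; lra.
have nl : (l - i.+1)%:R * eps <= n%:R * eps.
  by rewrite ler_pM2r// ler_nat (leq_trans (leq_subr _ _))// ltnW.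
have ne : eps <= n%:R * eps by rewrite ler_pMl// ler1n (leq_trans _ ln).
have xil : `|x l - x i| <= Lam * (n%:R * eps).
  have := c_lip (tk_ge i) (tk_mono (ltnW il)) (tk_le (ltnW ln)).
  move=> /le_trans; apply; rewrite ler_wpM2l// /tk.
  have : l%:R * eps <= n%:R * eps by rewrite ler_pM2r// ler_nat ltnW.
  have : 0 <= i%:R * eps by rewrite mulr_ge0// ltW.
  by lra.
have l1 := L_lip (xvX l (ltnW ln)) (xX i (ltnW iln)) qm_le.
have l2 := L_lip (xX i (ltnW iln)) (xX l (ltnW ln)) (pieces_le ln).
have l1' : `|x l + v - x i| <= Lam * (n%:R * eps) + Lam * eps.
  by rewrite addrAC (le_trans (ler_normD _ _))// lerD.
rewrite distrC in l2.
have {}l1 := le_trans l1 (ler_wpM2l C0 l1').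
have {}l2 := le_trans l2 (ler_wpM2l C0 xil).
have CL0 : 0 <= C * Lam by rewrite mulr_ge0.
(* After division by [eps], and with [eps <= n%:R * eps], the errors of the three stages and the
   change of base point from [x l] to [x i] add up to [6 * C * (Lam + 1)] times the window. *)
have := le_trans last_step (le_trans (reach l il (leqnn l)) (lerD first_step (lexx _))).
have {}nl := ler_wpM2l (_ : 0 <= 2 * C * (Lam + 1)) nl.
rewrite -/qm => main.
have : L (x l) (q l) - L (x l + v) qm - C * (Lam * eps) - 2 * C * eps <=
    L (x i) qm - L (x i) (q i) + 2 * C * eps +
    2 * C * (Lam + 1) * ((l - i.+1)%:R * eps).
  by rewrite -(ler_pM2l eps0); lra.
have nl' : 2 * C * (Lam + 1) * ((l - i.+1)%:R * eps) <=
    2 * C * (Lam + 1) * (n%:R * eps).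
  by apply: nl; rewrite !mulr_ge0// addr_ge0.
have ne1 := ler_wpM2l CL0 ne; have ne2 := ler_wpM2l C0 ne.
by lra.
Qed.

Lemma pieces_average : (0 < n)%N ->
  (n%:R * eps)^-1 *: (c (a + n%:R * eps) - c a) = n%:R^-1 *: \sum_(k < n) q k.
Proof.
move=> n0; have -> : c (a + n%:R * eps) - c a = \sum_(k < n) (x k.+1 - x k).
  rewrite -(big_mkord xpredT (fun k => x k.+1 - x k)) telescope_sumr//.
  by rewrite /x /tk mul0r addr0.
by rewrite invfM -scalerA scaler_sumr.
Qed.

Lemma grid_deviation (Q : V) (e : R) : (forall k, (k < n)%N -> `|q k - Q| <= e) ->
  forall k l, (k <= l)%N -> (l <= n)%N ->
  `|c (tk l) - c (tk k) - (tk l - tk k) *: Q| <= e * (tk l - tk k).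
Proof.
move=> qe k l /subnKC <-; elim: (l - k)%N => [|m ih].
  by rewrite addn0 !subrr scale0r subr0 normr0 mulr0.
rewrite addnS => kmn; have {}ih := ih (ltnW kmn).
have -> : tk (k + m).+1 - tk k = (tk (k + m) - tk k) + eps.
  by rewrite -(tkS (k + m)); ring.
have -> : c (tk (k + m).+1) - c (tk k) - (tk (k + m) - tk k + eps) *: Q =
    (c (tk (k + m)) - c (tk k) - (tk (k + m) - tk k) *: Q) + eps *: (q (k + m) - Q).
  rewrite -/(x (k + m).+1) xS scalerDl scalerBr opprD -/(x (k + m)).
  by rewrite (addrAC (x _)) addrACA.
rewrite (le_trans (ler_normD _ _))// mulrDr lerD//.
by rewrite normrZ gtr0_norm// mulrC ler_pM2r// qe.
Qed.

End pieces.

Lemma calibrated_window (e : R) : 0 < e -> exists2 d, 0 < d &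
  forall a a', t1 <= a -> a < a' -> a' <= t2 -> a' - a <= d ->
  forall s t, a <= s -> s <= t -> t <= a' ->
  `|c t - c s - (t - s) *: ((a' - a)^-1 *: (c a' - c a))| <= e * (t - s).
Proof.
move=> e0; have [kap k0 kP] := L_convex e0.
pose K6 := 6 * C * (Lam + 1).
have K60 : 0 <= K6 by rewrite !mulr_ge0// addr_ge0.
(* On such a window the second difference stays below the convexity modulus [kap], which forces
   slopes to be [e]-close; the [+ 1] makes this strict and the quotient meaningful when [K6 = 0]. *)
exists (kap / (K6 + 1)); first by rewrite divr_gt0// ltr_wpDl.
move=> a a' t1a aa' a't2 aa'd s t as_ st ta'.
set Q := _ *: (c a' - c a).
have a0 : 0 < a' - a by rewrite subr_gt0.
have K6d : K6 * (a' - a) < kap.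
  have : (K6 + 1) * (a' - a) <= kap by rewrite mulrC -ler_pdivlMr// ltr_wpDl.
  by lra.
(* The remainder of order [1 / n.+1] comes from rounding [s] and [t] to the grid; it vanishes under
   refinement because [d] does not depend on [n]. *)
have grid n : `|c t - c s - (t - s) *: Q| <=
    e * (t - s) + (2 * (Lam + `|Q|) + e) * (a' - a) / n.+1%:R.
  have n0 : 0 < n.+1%:R :> R by rewrite ltr0n.
  pose eps := (a' - a) / n.+1%:R.
  have eps0 : 0 < eps by rewrite divr_gt0.
  have neps : n.+1%:R * eps = a' - a by rewrite /eps mulrC divfK// gt_eqF.
  have nt2 : a + n.+1%:R * eps <= t2 by rewrite neps addrC subrK.
  pose tk k := a + k%:R * eps.
  pose q k := eps^-1 *: (c (tk k.+1) - c (tk k)).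
  have qq i l : (i < l)%N -> (l < n.+1)%N -> `|q i - q l| <= e.
    move=> il ln; rewrite leNgt; apply/negP => /ltW eq.
    have := pieces_second_difference t1a eps0 nt2 il ln.
    rewrite -/(tk _) neps -/K6 => sd.
    have := kP (c (tk i)) (q i) (q l).
    have tki : t1 <= tk i by rewrite (le_trans t1a)// lerDl mulr_ge0// ltW.
    have tki2 : tk i <= t2.
      apply: le_trans nt2; rewrite lerD2l ler_pM2r// ler_nat ltnW//.
      exact: ltn_trans ln.
    have t12 : t1 <= t2 by exact: le_trans tki2.
    have -> : `|c (tk i)| <= X.
      by apply: le_trans (c_bound tki tki2); rewrite lerDl mulr_ge0// subr_ge0.
    rewrite (pieces_le t1a eps0 nt2 (ltn_trans il ln)) (pieces_le t1a eps0 nt2 ln).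
    move=> /(_ isT isT isT eq) kq.
    move: sd kq K6d; rewrite -/(q i) -/(q l); lra.
  (* [Q] is the average of the slopes, so it is as close to each of them as they are to each
     other. *)
  have qQ l : (l < n.+1)%N -> `|q l - Q| <= e.
    move=> ln; have := pieces_average a eps (ltn0Sn n).
    rewrite neps [a + _]addrC subrK -/Q => ->.
    have -> : q l - n.+1%:R^-1 *: \sum_(k < n.+1) q k =
        n.+1%:R^-1 *: \sum_(k < n.+1) (q l - q k).
      rewrite sumrB sumr_const card_ord scalerBr -[q l *+ _]scaler_nat scalerA.
      by rewrite mulVf ?gt_eqF// scale1r.
    rewrite normrZ gtr0_norm ?invr_gt0// mulrC ler_pdivrMr//.
    rewrite (le_trans (ler_norm_sum _ _ _))//.
    have -> : e * n.+1%:R = \sum_(k < n.+1) e.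
      by rewrite sumr_const card_ord mulr_natr.
    apply: ler_sum => i _; have [il|li|->] := ltngtP i l.
    - by rewrite distrC qq.
    - by rewrite qq.
    - by rewrite subrr normr0 ltW.
  have grd := grid_deviation eps0 qQ.
  pose dev r r' := c r' - c r - (r' - r) *: Q.
  have dev_lip r r' : a <= r -> r <= r' -> r' <= a' ->
      `|dev r r'| <= (Lam + `|Q|) * (r' - r).
    move=> ar rr' r'a'; rewrite /dev (le_trans (ler_normB _ _))// mulrDl lerD//.
      by apply: c_lip => //; [exact: le_trans ar|exact: le_trans a't2].
    by rewrite normrZ ger0_norm ?subr_ge0// mulrC.
  pose k r := Num.truncn ((r - a) / eps).
  have near_grid r : a <= r -> r <= a' ->
      [/\ (k r <= n.+1)%N, tk (k r) <= r & r <= tk (k r) + eps].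
    move=> ar ra'; have r0 : 0 <= (r - a) / eps.
      by rewrite divr_ge0 ?subr_ge0// ltW.
    have /andP[kr rk] := truncn_itv r0; split.
    - rewrite -(ler_nat R) (le_trans kr)// ler_pdivrMr// neps.
      by rewrite lerD2r.
    - by move: kr; rewrite -/(k r) ler_pdivlMr// /tk; lra.
    - by move: rk; rewrite -/(k r) ltr_pdivrMr// -natr1 /tk; lra.
  have sa' : s <= a' := le_trans st ta'; have a_t : a <= t := le_trans as_ st.
  have [k1n k1s sk1] := near_grid s as_ sa'.
  have [k2n k2t tk2] := near_grid t a_t ta'.
  have ak k' : a <= tk k' by rewrite lerDl mulr_ge0// ltW.
  have LQ : 0 <= Lam + `|Q| by rewrite addr_ge0.
  have tail r k' : tk k' <= r -> r <= tk k' + eps -> r <= a' ->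
      `|dev (tk k') r| <= (Lam + `|Q|) * eps.
    move=> kr rk ra'; apply: le_trans (dev_lip _ _ (ak _) kr ra') _.
    by rewrite ler_wpM2l//; lra.
  have t1_ := tail s _ k1s sk1 sa'; have t2_ := tail t _ k2t tk2 ta'.
  have k12 : (k s <= k t)%N.
    by apply: le_truncn; rewrite ler_pM2r ?invr_gt0// lerD2r.
  have t3_ := grd _ _ k12 k2n.
  have devD r r' r'' : dev r r' + dev r' r'' = dev r r''.
    rewrite /dev addrACA -opprD -scalerDl; congr (_ - _ *: _); last by ring.
    by rewrite addrC addrA subrK.
  have -> : c t - c s - (t - s) *: Q = dev (tk (k t)) t + dev (tk (k s)) (tk (k t)) -
      dev (tk (k s)) s.
    by rewrite (addrC (dev (tk (k t)) t)) devD -(devD _ s t) [RHS]addrC addKr.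
  rewrite (le_trans (ler_normB _ _))//.
  have := ler_normD (dev (tk (k t)) t) (dev (tk (k s)) (tk (k t))).
  have -> : (2 * (Lam + `|Q|) + e) * (a' - a) / n.+1%:R =
      (2 * (Lam + `|Q|) + e) * eps by rewrite mulrA.
  have : e * (tk (k t) - tk (k s)) <= e * (t - s + eps) by rewrite ler_pM2l//; lra.
  by move: t1_ t2_ t3_; rewrite -/(dev (tk (k s)) (tk (k t))) -/(tk (k s)) -/(tk (k t)); lra.
apply/ler_addgt0Pr => d d0.
pose B := (2 * (Lam + `|Q|) + e) * (a' - a).
have B0 : 0 <= B.
  by rewrite /B mulr_ge0 ?(ltW a0)// addr_ge0 ?(ltW e0)// mulr_ge0// addr_ge0.
apply: (le_trans (grid (Num.truncn (B / d)))); rewrite lerD2l.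
by rewrite -/B ler_pdivrMr// mulrC -ler_pdivrMr// ltW// truncnS_gt.
Qed.

End calibrated_curve.

(** * From nearly constant slopes to one-sided derivatives *)

Section strictly_differentiable.
Context {R : realType} {N : nat}.
Notation V := 'rV[R]_N.
Variables (f : R -> V) (t1 t2 : R).
Hypothesis t12 : t1 < t2.
Hypothesis f_strict : forall e, 0 < e -> exists2 d, 0 < d &
  forall a a', t1 <= a -> a < a' -> a' <= t2 -> a' - a <= d -> exists Q : V,
  forall s t, a <= s -> s <= t -> t <= a' ->
  `|f t - f s - (t - s) *: Q| <= e * (t - s).

Lemma strict_local_slope (e : R) : 0 < e -> exists2 d, 0 < d &
  forall s, t1 <= s -> s <= t2 -> exists Q : V, forall t, t1 <= t -> t <= t2 ->
  `|t - s| <= d -> `|f t - f s - (t - s) *: Q| <= e * `|t - s|.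
Proof.
(* Half of [d], since the window is centred at [s] so that one slope serves both sides. *)
move=> e0; have [d d0 dP] := f_strict e0; exists (d / 2); first by rewrite divr_gt0.
move=> s t1s st2.
pose a := Num.max t1 (s - d / 2); pose a' := Num.min t2 (s + d / 2).
have [|||| Q QP] := dP a a'.
- by rewrite /a le_max lexx.
- rewrite /a /a' lt_min !gt_max t12/=; apply/and3P; split; lra.
- by rewrite /a' ge_min lexx.
- have : a' <= s + d / 2 by rewrite /a' ge_min lexx orbT.
  have : s - d / 2 <= a by rewrite /a le_max lexx orbT.
  by lra.
have as_ : a <= s by rewrite /a ge_max t1s; lra.
have sa' : s <= a' by rewrite /a' le_min st2; lra.
exists Q => t t1t tt2; rewrite ler_norml => /andP[td1 td2].
have at_ : a <= t by rewrite /a ge_max t1t; lra.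
have ta' : t <= a' by rewrite /a' le_min tt2; lra.
have [st|/ltW ts] := leP s t; first by rewrite ger0_norm ?subr_ge0// QP.
rewrite ler0_norm ?subr_le0// opprB -normrN.
have -> : - (f t - f s - (t - s) *: Q) = f s - f t - (s - t) *: Q.
  by rewrite opprB addrC opprB -[t - s]opprB scaleNr.
exact: QP.
Qed.

(** The slopes [Q] depend on [e], but they trap the difference quotients at [s], which are thus
    Cauchy; their limit replaces [Q] at the price of [e / 2]. *)
Lemma strict_derivative : exists g : R -> V,
  forall e, 0 < e -> exists2 d, 0 < d & forall s t, t1 <= s -> s <= t2 ->
  t1 <= t -> t <= t2 -> `|t - s| <= d ->
  `|f t - f s - (t - s) *: g s| <= e * `|t - s|.
Proof.
(* [w s] points from [s] into the interval, so that [s + w s / (n + 1)] stays in it. *)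
pose w s : R := if s <= (t1 + t2) / 2 then (t2 - t1) / 2 else - ((t2 - t1) / 2).
pose h s (n : nat) : R := w s / n.+1%:R.
have w_neq0 s : w s != 0.
  by rewrite /w; case: ifP => _; rewrite ?oppr_eq0 gt_eqF// divr_gt0// subr_gt0.
have h_neq0 s n : h s n != 0 by rewrite /h mulf_neq0// invr_eq0 pnatr_eq0.
have h_cvg s : h s n @[n --> \oo] --> (0 : R).
  rewrite -[0](mulr0 (w s)); apply: cvgM; [exact: cvg_cst|exact: cvg_harmonic].
have h_in s n : t1 <= s -> s <= t2 -> t1 <= s + h s n /\ s + h s n <= t2.
  move=> t1s st2; have [n0 n1] : 0 <= (n.+1%:R : R)^-1 /\ (n.+1%:R : R)^-1 <= 1.
    by rewrite invr_ge0 invf_le1 ?ltr0n// ler1n.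
  have w0 : 0 <= (t2 - t1) / 2 by move: t12; lra.
  rewrite /h; move: (n.+1%:R^-1) n0 n1 => r n0 n1.
  have r1 := ler_wpM2l w0 n1; have r0 := mulr_ge0 w0 n0.
  by rewrite /w; case: (leP s ((t1 + t2) / 2)) => hs; rewrite ?mulNr; split; lra.
pose u s (n : nat) : V := (h s n)^-1 *: (f (s + h s n) - f s).
have u_near s e d (Q : V) : t1 <= s -> s <= t2 -> 0 < d ->
    (forall t, t1 <= t -> t <= t2 ->
      `|t - s| <= d -> `|f t - f s - (t - s) *: Q| <= e * `|t - s|) ->
    \forall n \near \oo, `|u s n - Q| <= e.
  move=> t1s st2 d0 QP; near=> n.
  have [h1 h2] := h_in s n t1s st2.
  have hd : `|h s n| <= d.
    by rewrite -[h s n]opprK normrN -sub0r; near: n; exact: (cvgr_dist_le _ _ (h_cvg s) _ d0).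
  have := QP _ h1 h2; rewrite [s + _]addrC addrK => /(_ hd).
  rewrite [h s n + s]addrC => fh.
  have -> : u s n - Q = (h s n)^-1 *: (f (s + h s n) - f s - h s n *: Q).
    by rewrite scalerBr scalerA mulVf// scale1r.
  by rewrite normrZ normfV mulrC ler_pdivrMr// normr_gt0.
have u_cvg s : t1 <= s -> s <= t2 -> cvgn (u s).
  move=> t1s st2; apply/cauchy_cvgP/cauchy_exP => e e0.
  have e20 : 0 < e / 2 by rewrite divr_gt0.
  have [d d0 dP] := strict_local_slope e20.
  have [Q QP] := dP s t1s st2; exists Q.
  have := u_near s (e / 2) d Q t1s st2 d0 QP; apply: filterS => n un.
  rewrite -ball_normE /ball_ /= distrC (le_lt_trans un)//.
  by rewrite ltr_pdivrMr// ltr_pMr// ltr1n.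
exists (fun s => limn (u s)) => e e0.
have e20 : 0 < e / 2 by rewrite divr_gt0.
have [d d0 dP] := strict_local_slope e20; exists d => // s t t1s st2 t1t tt2 td.
have [Q QP] := dP s t1s st2.
have lQ : `|limn (u s) - Q| <= e / 2.
  apply: (cvgr_to_le _ (u_near s (e / 2) d Q t1s st2 d0 QP)).
  by apply: cvg_norm; apply: cvgB; [exact: u_cvg|exact: cvg_cst].
have -> : f t - f s - (t - s) *: limn (u s) =
    (f t - f s - (t - s) *: Q) - (t - s) *: (limn (u s) - Q).
  by rewrite scalerBr opprB addrA subrK.
rewrite (le_trans (ler_normB _ _))// (splitr e) mulrDl lerD//; first exact: QP.
by rewrite normrZ mulrC ler_wpM2r.
Unshelve. all: by end_near. Qed.

End strictly_differentiable.

Section one_sided_derivatives.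
Context {R : realType} {V : normedModType R}.
Variables (f g : R -> V) (t1 t2 : R).
Hypothesis f_deriv : forall e, 0 < e -> exists2 d, 0 < d & forall s t,
  t1 <= s -> s <= t2 -> t1 <= t -> t <= t2 -> `|t - s| <= d ->
  `|f t - f s - (t - s) *: g s| <= e * `|t - s|.

Let quotient_le s h e : h != 0 -> `|f (s + h) - f s - h *: g s| <= e * `|h| ->
  `|g s - h^-1 *: (f (s + h) - f s)| <= e.
Proof.
move=> h0 fh; rewrite distrC.
have -> : h^-1 *: (f (s + h) - f s) - g s = h^-1 *: (f (s + h) - f s - h *: g s).
  by rewrite [in RHS]scalerBr scalerA mulVf// scale1r.
by rewrite normrZ normfV mulrC ler_pdivrMr// normr_gt0.
Qed.

Lemma uniform_right_deriv s : t1 <= s -> s < t2 -> is_right_deriv f s (g s).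
Proof.
move=> t1s st2; apply/cvgrPdist_le => e e0; have [d d0 dP] := f_deriv e0.
near=> h; have h0 : 0 < h by near: h; exact: nbhs_right_gt.
have hd : h <= d by near: h; exact: nbhs_right_le.
have ht : h <= t2 - s by near: h; apply: nbhs_right_le; rewrite subr_gt0.
apply: quotient_le; first by rewrite gt_eqF.
have := dP s (s + h) t1s (ltW st2); rewrite [s + h - s]addrAC subrr add0r.
by apply; [rewrite ler_wpDr// ltW|lra|rewrite gtr0_norm].
Unshelve. all: by end_near. Qed.

Lemma uniform_left_deriv s : t1 < s -> s <= t2 -> is_left_deriv f s (g s).
Proof.
move=> t1s st2; apply/cvgrPdist_le => e e0; have [d d0 dP] := f_deriv e0.
near=> h; have h0 : h < 0 by near: h; exact: nbhs_left_lt.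
have hd : - d <= h by near: h; apply: nbhs_left_ge; rewrite oppr_lt0.
have ht : t1 - s <= h by near: h; apply: nbhs_left_ge; rewrite subr_lt0.
apply: quotient_le; first by rewrite lt_eqF.
have := dP s (s + h) (ltW t1s) st2; rewrite [s + h - s]addrAC subrr add0r.
by apply; [lra|lra|rewrite ltr0_norm// lerNl].
Unshelve. all: by end_near. Qed.

Lemma uniform_derive s : t1 < s -> s < t2 -> is_derive s 1 f (g s).
Proof.
move=> t1s st2.
have cv : h^-1 *: (f (h *: 1 + s) - f s) @[h --> 0^'] --> g s.
  apply/cvgrPdist_le => e e0; have [d d0 dP] := f_deriv e0.
  near=> h; have h0 : h != 0 by near: h; exact: nbhs_dnbhs_neq.
  have hd : `|h| <= Num.min d (Num.min (s - t1) (t2 - s)).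
    near: h; apply: dnbhs0_le; rewrite !lt_min d0/=.
    by apply/andP; split; lra.
  move: hd; rewrite !le_min => /and3P[hd h1 h2].
  rewrite [h *: 1]mulr1 [h + s]addrC; apply: quotient_le => //.
  have := dP s (s + h) (ltW t1s) (ltW st2); rewrite [s + h - s]addrAC subrr add0r.
  move=> /(_ _ _ hd); apply.
    by move: h1; rewrite ler_norml => /andP[]; lra.
  by move: h2; rewrite ler_norml => /andP[]; lra.
by split; [apply/cvg_ex; exists (g s)|exact: cvg_lim].
Unshelve. all: by end_near. Qed.

(** As [d] is uniform in the base point, [s] and [t] may be exchanged in [f_deriv]; adding the two
    expansions isolates [g s - g t]. *)
Lemma uniform_deriv_continuous e : 0 < e -> exists2 d, 0 < d & forall s t,
  t1 <= s -> s <= t2 -> t1 <= t -> t <= t2 -> `|t - s| <= d -> `|g s - g t| <= e.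
Proof.
move=> e0; have e20 : 0 < e / 2 by rewrite divr_gt0.
have [d d0 dP] := f_deriv e20; exists d => // s t t1s st2 t1t tt2 td.
have [->|st] := eqVneq s t; first by rewrite subrr normr0 ltW.
have ts0 : 0 < `|t - s| by rewrite normr_gt0 subr_eq0 eq_sym.
rewrite -(ler_pM2l ts0) -normrZ.
have -> : (t - s) *: (g s - g t) =
    - ((f s - f t - (s - t) *: g t) + (f t - f s - (t - s) *: g s)).
  rewrite addrACA [f s - f t + _]addrA subrK subrr add0r -[s - t]opprB scaleNr.
  by rewrite opprK opprB -scalerBr.
rewrite normrN (le_trans (ler_normD _ _))//.
have := dP s t t1s st2 t1t tt2 td; have := dP t s t1t tt2 t1s st2.
by rewrite [`|s - t|]distrC => /(_ td); lra.
Qed.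

Lemma derive1_right_limit s : t1 <= s -> s < t2 ->
  derive1 f r @[r --> s^'+] --> g s.
Proof.
move=> t1s st2; apply/cvgrPdist_le => e e0.
have [d d0 dP] := uniform_deriv_continuous e0.
near=> r; have sr : s < r by near: r; exact: nbhs_right_gt.
have rt2 : r < t2 by near: r; exact: nbhs_right_lt.
have rd : r <= s + d by near: r; apply: nbhs_right_le; rewrite ltrDl.
have [_ fr] := uniform_derive (le_lt_trans t1s sr) rt2.
rewrite derive1E fr; apply: dP => //; try exact: ltW.
  exact: le_trans (ltW sr).
by rewrite gtr0_norm ?subr_gt0// lerBlDl.
Unshelve. all: by end_near. Qed.

Lemma derive1_left_limit s : t1 < s -> s <= t2 ->
  derive1 f r @[r --> s^'-] --> g s.
Proof.
move=> t1s st2; apply/cvgrPdist_le => e e0.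
have [d d0 dP] := uniform_deriv_continuous e0.
near=> r; have sr : r < s by near: r; exact: nbhs_left_lt.
have rt1 : t1 < r by near: r; exact: nbhs_left_gt.
have rd : s - d <= r by near: r; apply: nbhs_left_ge; rewrite ltrBlDr ltrDl.
have [_ fr] := uniform_derive rt1 (lt_le_trans sr st2).
rewrite derive1E fr; apply: dP => //; try exact: ltW.
  exact: le_trans (ltW sr) st2.
by rewrite ltr0_norm ?subr_lt0//; lra.
Unshelve. all: by end_near. Qed.

Lemma derive1_continuous s : t1 < s -> s < t2 ->
  {for s, continuous (derive1 f)}.
Proof.
move=> t1s st2; have [_ fs] := uniform_derive t1s st2.
rewrite /prop_for /continuous_at derive1E fs; apply/cvgrPdist_le => e e0.
have [d d0 dP] := uniform_deriv_continuous e0.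
near=> r; have rt1 : t1 < r by near: r; exact: lt_nbhsr.
have rt2 : r < t2 by near: r; exact: lt_nbhsl.
have rd : `|r - s| <= d.
  by rewrite distrC; near: r; exact: (cvgr_dist_le _ _ (@cvg_id _ (nbhs s)) _ d0).
have [_ fr] := uniform_derive rt1 rt2.
by rewrite derive1E fr; apply: dP => //; exact: ltW.
Unshelve. all: by end_near. Qed.

End one_sided_derivatives.

(** * Estimates for the solution and its coupling term *)

Lemma lipschitz_slab (R : realType) (N m : nat) (S : R)
    (u : R -> 'rV[R]_N -> 'cV[R]_m.+1) :
  [lipschitz u z.1 z.2 | z in @slab R N S] ->
  exists2 K, 0 <= K & forall r r' z z', 0 <= r <= S -> 0 <= r' <= S ->
  forall i, `|u r z i ord0 - u r' z' i ord0| <= K * (`|r - r'| + `|z - z'|).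
Proof.
move=> [M [_ HM]]; exists (`|M| + 1); first by rewrite addr_ge0.
move=> r r' z z' rS r'S i.
have /HM/(_ ((r, z), (r', z')) (conj rS r'S)) /= : M < `|M| + 1.
  by rewrite (le_lt_trans (ler_norm _))// ltrDl.
move=> h; apply: (@le_trans _ _ `|u r z - u r' z'|).
  have -> : u r z i ord0 - u r' z' i ord0 = (u r z - u r' z') i ord0 by rewrite !mxE.
  by rewrite [leRHS]/Num.norm/= mx_normrE (le_bigmax _ _ (i, ord0)).
apply: (le_trans h); rewrite ler_wpM2l ?addr_ge0//.
by rewrite prod_normE /= ge_max lerDl lerDr !normr_ge0.
Qed.

Lemma bounded_slab (R : realType) (N m : nat) (S : R)
    (u : R -> 'rV[R]_N -> 'cV[R]_m.+1) :
  [bounded u z.1 z.2 | z in @slab R N S] ->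
  exists2 K, 0 <= K & forall r z i, 0 <= r <= S -> `|u r z i ord0| <= K.
Proof.
move=> [M [_ HM]]; exists (`|M| + 1); first by rewrite addr_ge0.
move=> r z i rS.
have /HM/(_ (r, z) rS) /= : M < `|M| + 1.
  by rewrite (le_lt_trans (ler_norm _))// ltrDl.
apply: le_trans; rewrite [leRHS]/Num.norm/= mx_normrE.
exact: (le_bigmax _ _ (i, ord0)).
Qed.

Section coupled_term.
Context {R : realType} {N m : nat} (B : 'M[R]_m.+1) (u : R -> 'rV[R]_N -> 'cV[R]_m.+1).

Let rowsum (j : 'I_m.+1) : R := \sum_k `|B j k|.

Lemma coupling_lipschitz (K : R) (j : 'I_m.+1) r r' z z' :
  (forall i, `|u r z i ord0 - u r' z' i ord0| <= K * (`|r - r'| + `|z - z'|)) ->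
  (B *m u r z) j ord0 - (B *m u r' z') j ord0 <=
  (rowsum j * K) * (`|r - r'| + `|z - z'|).
Proof.
move=> uK; rewrite !mxE -sumrB /rowsum -mulrA mulr_suml; apply: ler_sum => k _.
by rewrite -mulrBr (le_trans (ler_norm _))// normrM ler_wpM2l.
Qed.

Lemma coupling_bounded (K : R) (j : 'I_m.+1) r z :
  (forall i, `|u r z i ord0| <= K) -> (B *m u r z) j ord0 <= rowsum j * K.
Proof.
move=> uK; rewrite mxE /rowsum mulr_suml; apply: ler_sum => k _.
by rewrite (le_trans (ler_norm _))// normrM ler_wpM2l.
Qed.

End coupled_term.

(** * Arcs on which the state is constant *)

Section calibrated_arc.
Context {R : realType} {N m : nat}.
Notation V := 'rV[R]_N.+1.
Variables (H : 'I_m.+1 -> V -> V -> R) (B : 'M[R]_m.+1) (u : R -> V -> 'cV[R]_m.+1).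
Variables (T : R) (j : 'I_m.+1) (f : R -> V) (a b : R).
Hypothesis H_ham : hamiltonians H.
Hypothesis u_sub : viscosity_subsolution H B u.
Hypothesis u_bounded : forall S, 0 < S -> [bounded u z.1 z.2 | z in @slab R N.+1 S].
Hypothesis u_lip : forall S, 0 < S -> [lipschitz u z.1 z.2 | z in @slab R N.+1 S].
Hypotheses (a0 : 0 <= a) (ab : a < b) (bT : b <= T).
Hypothesis f_ac : forall k, seg_ac T (fun x => `|f x.2 ord0 k - f x.1 ord0 k|).
Hypothesis f_cal : forall s t, a <= s -> s < t -> t <= b ->
  (u (T - s) (f s) j ord0 - u (T - t) (f t) j ord0)%:E =
  (\int[lebesgue_measure]_(r in `[s, t])
    (lagrangianG H B u j (T - r) (f r) (- derive1 f r))%:E)%E.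

Let h := H j.
Let U r z := u r z j ord0.
Let cp r z := (B *m u r z) j ord0.

Let T0 : 0 < T. Proof. by rewrite (le_lt_trans a0)// (lt_le_trans ab). Qed.

Ltac arc_lra :=
  clear - H_ham u_sub u_bounded u_lip a0 ab bT f_ac f_cal h U cp T0; lra.

Lemma calibrated_fenchel s t p K : a <= s -> s < t -> t <= b ->
  (forall r, s <= r <= t -> h (f r) p + cp (T - r) (f r) <= K) ->
  dotv p (f s - f t) - K * (t - s) <= U (T - s) (f s) - U (T - t) (f t).
Proof.
move=> as_ st tb pK; have [_ [al [be [al_sl _ hb]]] _ hC1] := H_ham.
have tT := le_trans tb bT.
rewrite -lee_fin [leRHS]f_cal//; apply: (action_lower_bound f_ac _ st tT).
  exact: le_trans a0 as_.
move=> r rst; have := pK r rst.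
have := legendre_ge (hC1 j) al_sl (hb j) (f r) (- derive1 f r) p.
by rewrite /lagrangianG /lagrangian -/h -/(cp _ _); lra.
Qed.

(* Fenchel's inequality with [p] of norm one more than the Lipschitz constant of [U]. *)
Lemma calibrated_lipschitz : exists2 Lam, 0 <= Lam & forall s t,
  a <= s -> s <= t -> t <= b -> `|f t - f s| <= Lam * (t - s).
Proof.
have [_ [al [be [al_sl _ hb]]] _ hC1] := H_ham.
have [Ku Ku0 uL] := lipschitz_slab (u_lip T0).
have [Mu Mu0 uM] := bounded_slab (u_bounded T0).
(* [K] bounds [h (f r) p + cp (T - r) (f r)] for [enorm p = Ku + 1]. The Lipschitz bound [Ku] on [U]
   then absorbs all but one unit of the pairing. *)
pose K := be (Ku + 1) + (\sum_k `|B j k|) * Mu.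
exists (`|K| + Ku); first by rewrite addr_ge0.
move=> s t as_; rewrite le_eqVlt => /predU1P[<- _|st tb].
  by rewrite !subrr normr0 mulr0.
have [k kE] := norm_coord_eq (f s - f t).
(* Directed along a coordinate realizing the max norm, so that the pairing equals [(Ku + 1)] times
   that norm. *)
pose p : V := (Num.sg ((f s - f t) ord0 k) * (Ku + 1)) *: delta_mx 0 k.
have Ku1 : 0 <= Ku + 1 by rewrite addr_ge0.
have pE (q : V) : dotv p q = Num.sg ((f s - f t) ord0 k) * (Ku + 1) * q ord0 k.
  rewrite dotvZl; congr (_ * _); rewrite /dotv (bigD1 k)//= big1 ?addr0.
    by rewrite mxE !eqxx mul1r.
  by move=> i ik; rewrite mxE eqxx (negbTE ik) mul0r.
have dp : dotv p (f s - f t) = (Ku + 1) * `|f s - f t|.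
  by rewrite pE mulrAC -normrEsg mulrC kE.
have tsT r : s <= r <= t -> 0 <= T - r <= T.
  by move=> /andP[]; move: a0 bT as_ tb; lra.
have [f0|f0] := eqVneq (f s - f t) 0.
  rewrite distrC f0 normr0 mulr_ge0 ?subr_ge0 ?(ltW st)// addr_ge0//.
have ep : enorm p = Ku + 1.
  have pk : p ord0 k = Num.sg ((f s - f t) ord0 k) * (Ku + 1).
    by rewrite /p [LHS]mxE [delta_mx _ _ _ _]mxE !eqxx mulr1.
  rewrite /enorm pE pk -expr2 sqrtr_sqr normrM normr_sg.
  by rewrite -normr_eq0 -kE normr_eq0 f0 mul1r ger0_norm.
have := @calibrated_fenchel s t p K as_ st tb.
rewrite dp => /(_ _) main.
have {}main := main _.
have Ul : U (T - s) (f s) - U (T - t) (f t) <= Ku * ((t - s) + `|f s - f t|).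
  apply: (le_trans (ler_norm _)); apply: le_trans (uL _ _ _ _ _ _ _) _.
  - by apply: tsT; rewrite lexx ltW.
  - by apply: tsT; rewrite lexx ltW.
  - have -> : T - s - (T - t) = t - s by ring.
    by rewrite gtr0_norm ?subr_gt0.
have : (Ku + 1) * `|f s - f t| - K * (t - s) <= Ku * ((t - s) + `|f s - f t|).
  apply: le_trans Ul; apply: main => r rst.
  rewrite /K lerD//.
    by have /andP[_] := hb j (f r) p; rewrite ep.
  by apply: coupling_bounded => i; apply: uM; exact: tsT.
have : K * (t - s) <= `|K| * (t - s) by rewrite ler_wpM2r ?ler_norm// subr_ge0 ltW.
by rewrite [`|f t - f s|]distrC mulrDl; lra.
Qed.

Lemma calibrated_strict (e : R) : 0 < e -> exists2 d, 0 < d &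
  forall a' b', a <= a' -> a' < b' -> b' <= b -> b' - a' <= d -> exists Q : V,
  forall s t, a' <= s -> s <= t -> t <= b' ->
  `|f t - f s - (t - s) *: Q| <= e * (t - s).
Proof.
have [_ [al [be [al_sl _ hb]]] _ hC1] := H_ham.
have [Lam Lam0 fL] := calibrated_lipschitz.
(* Twice [T], because the tube around a segment is continued up to time [t + (t - s)], which may
   exceed [T]. *)
have TT0 : 0 < 2 * T by rewrite mulr_gt0.
have [Ku Ku0 uL] := lipschitz_slab (u_lip TT0).
pose Kb := (\sum_k `|B j k|) * Ku.
have Kb0 : 0 <= Kb by rewrite mulr_ge0// sumr_ge0.
pose c t := f (T - t); pose t1 := T - b; pose t2 := T - a.
have t1_0 : 0 <= t1 by rewrite subr_ge0.
have t2T : t2 <= T by rewrite /t2; move: a0; lra.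
have t21 : t2 - t1 = b - a by rewrite /t1 /t2; ring.
have cpL r r' z z' : 0 <= r <= 2 * T -> 0 <= r' <= 2 * T ->
    cp r z - cp r' z' <= Kb * (`|r - r'| + `|z - z'|).
  by move=> rT r'T; apply: coupling_lipschitz => i; exact: uL.
have cL s t : t1 <= s -> s <= t -> t <= t2 -> `|c t - c s| <= Lam * (t - s).
  rewrite /t1 /t2 /c => h1 st h2; rewrite distrC.
  have -> : t - s = (T - s) - (T - t) by ring.
  by apply: fL; move: h1 st h2; arc_lra.
pose X := `|f b| + 2 * (Lam * (b - a)).
have ba0 : 0 <= Lam * (b - a) by rewrite mulr_ge0// subr_ge0 ltW.
have cX s : t1 <= s -> s <= t2 -> `|c s| + Lam * (t2 - t1) <= X.
  move=> t1s st2; rewrite t21 /X.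
  have := cL t1 s (lexx _) t1s st2; have : Lam * (s - t1) <= Lam * (b - a).
    by rewrite ler_wpM2l// -t21 lerD2r.
  have -> : c t1 = f b by rewrite /c /t1 subKr.
  have := ler_normD (c s - f b) (f b); rewrite subrK; lra.
(* Contains the tubes: their points lie within [(2 * Lam + 1) * (t - s)] of the starting point, and
   [t - s <= T]. *)
pose X' := X + T + 2 * T * Lam.
have XX' : X <= X'.
  by have := mulr_ge0 (ltW TT0) Lam0; move: T0; rewrite /X'; lra.
have [P P0 LP] := legendre_le al_sl (hb j) Lam.
have [CL CL0 LL] := legendre_lipschitz (hC1 j) al_sl (hb j) X' Lam.
have [Ch Ch0 hL] := C1_lipschitz_ball (hC1 j) (Num.max X' P).
pose L (x q : V) := sup (range (fun p => dotv p q - H j x p)).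
(* The first two terms are the error in [dom]; [cal] needs only [Ch * Lam + Kb * (Lam + 1)]. *)
pose C := CL * (2 * Lam + 1) + Kb * (2 * Lam + 3) + Ch * Lam.
have [CLL KbL ChL] : [/\ 0 <= CL * Lam, 0 <= Kb * Lam & 0 <= Ch * Lam].
  by split; exact: mulr_ge0.
have C0 : 0 <= C by rewrite /C; lra.
have hxX s : t1 <= s -> s <= t2 -> `|c s| <= X.
  move=> t1s st2; apply: le_trans (cX s t1s st2); rewrite lerDl t21.
  exact: ba0.
have hlip x x' p : `|x| <= X' -> `|x'| <= X' -> `|p| <= P ->
    h x p - h x' p <= Ch * `|x - x'|.
  move=> xX x'X pP; have := hL (x, p) (x', p); rewrite !prod_normE /= !subrr !normr0.
  rewrite !ge_max !le_max xX x'X pP !orbT/= => /(_ isT isT).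
  by rewrite max_l// => /(le_trans (ler_norm _)).
have inT s : t1 <= s -> s <= t2 -> 0 <= s <= 2 * T.
  by move: T0 t1_0 t2T; arc_lra.
have cal s t : t1 <= s -> s < t -> t <= t2 ->
    (t - s) * (L (c s) ((t - s)^-1 *: (c t - c s)) - cp s (c s) - C * (t - s)) <=
    U t (c t) - U s (c s).
  move=> t1s st tt2; have ts0 : 0 < t - s by rewrite subr_gt0.
  have st2 : s <= t2 by rewrite (le_trans (ltW st)).
  have t1t : t1 <= t by rewrite (le_trans _ (ltW st)).
  suff : L (c s) ((t - s)^-1 *: (c t - c s)) <=
      (U t (c t) - U s (c s)) / (t - s) + cp s (c s) + C * (t - s).
    set l := L _ _; set x := U _ _ - _ => le_l.
    have {}le_l : l - cp s (c s) - C * (t - s) <= x / (t - s).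
      by move: le_l; arc_lra.
    by rewrite mulrC -ler_pdivlMr.
  apply: LP => [|p pP].
    rewrite normrZ gtr0_norm ?invr_gt0// mulrC ler_pdivrMr//.
    exact: cL (ltW st) tt2.
  have := @calibrated_fenchel (T - t) (T - s) p
    (h (c s) p + cp s (c s) + C * (t - s)).
  have -> : T - s - (T - t) = t - s by ring.
  rewrite !subKr -/(c t) -/(c s) => main.
  have {}main : dotv p (c t - c s) -
      (h (c s) p + cp s (c s) + C * (t - s)) * (t - s) <= U t (c t) - U s (c s).
    apply: main; rewrite ?ltrD2l ?ltrN2//; try by move: t1s tt2; rewrite /t1 /t2; arc_lra.
    move=> r /andP[tr rs]; pose r' := T - r.
    have -> : f r = c r' by rewrite /c /r' subKr.
    rewrite -/r'; have [sr' r't] : s <= r' /\ r' <= t.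
      by rewrite /r'; split; move: tr rs; arc_lra.
    have t1r' := le_trans t1s sr'; have r't2 := le_trans r't tt2.
    have cc := cL s r' t1s sr' r't2.
    have h1 := hlip _ _ p (le_trans (hxX _ t1r' r't2) XX')
      (le_trans (hxX _ t1s st2) XX') pP.
    have h2 := cpL _ _ (c r') (c s) (inT _ t1r' r't2) (inT _ t1s st2).
    have r's : Lam * (r' - s) <= Lam * (t - s) by rewrite ler_wpM2l// lerD2r.
    have {}cc := le_trans cc r's.
    have := ler_wpM2l Ch0 cc; have := ler_wpM2l Kb0 cc.
    have : Kb * (r' - s) <= Kb * (t - s) by rewrite ler_wpM2l// lerD2r.
    move: h2; rewrite (ger0_norm (_ : 0 <= r' - s)) ?subr_ge0// mulrDr.
    have : 0 <= CL * (2 * Lam + 1) * (t - s).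
      by rewrite mulr_ge0 ?(ltW ts0)// mulr_ge0// addr_ge0// mulr_ge0.
    have : 0 <= Kb * Lam * (t - s) by rewrite mulr_ge0// ltW.
    have : 0 <= Kb * (t - s) by rewrite mulr_ge0// ltW.
    by rewrite /C; move: h1; arc_lra.
  have : dotv p ((t - s)^-1 *: (c t - c s)) * (t - s) = dotv p (c t - c s).
    by rewrite dotvZr mulrAC mulVf ?mul1r// gt_eqF.
  move: main; set d := dotv p (c t - c s); set q := dotv p _; set x := U t _ - _.
  move=> main qE.
  have {}main : q - (h (c s) p + cp s (c s) + C * (t - s)) <= x / (t - s).
    by rewrite ler_pdivlMr// mulrBl qE.
  by move: main; rewrite -/h; arc_lra.
have dom s t y q : t1 <= s -> s < t -> t <= t2 -> `|y| <= X -> `|q| <= Lam ->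
    U t (y + (t - s) *: q) - U s y <= (t - s) * (L y q - cp s y + C * (t - s)).
  move=> t1s st tt2 yX qL; rewrite [leRHS]mulrC.
  have ts0 : 0 < t - s by rewrite subr_gt0.
  have uL' r r' z z' : 0 <= r <= 2 * T -> 0 <= r' <= 2 * T ->
      `|U r z - U r' z'| <= Ku * (`|r - r'| + `|z - z'|).
    by move=> rT r'T; exact: uL.
  have s0 : 0 <= s by exact: le_trans t1s.
  have t'T : t + (t - s) <= 2 * T by move: s0 tt2 t2T; arc_lra.
  have tt' : t < t + (t - s) by rewrite ltrDl.
  (* Taking both the radius of the tube and the extra time equal to [t - s] makes the error in the
     slope bound [O(t - s)]. *)
  apply: (subsolution_segment (h := h) (b := cp) (@u_sub j) Ku0 uL' s0 st tt' t'T ts0).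
  move=> r z p /andP[sr rt'] zq.
  have rs0 : 0 <= r - s by rewrite subr_ge0.
  have rs2 : r - s <= 2 * (t - s) by move: rt'; arc_lra.
  have zy : `|z - y| <= (2 * Lam + 1) * (t - s).
    have -> : z - y = (z - y - (r - s) *: q) + (r - s) *: q by rewrite subrK.
    rewrite (le_trans (ler_normD _ _))// normrZ (ger0_norm rs0).
    have : (r - s) * `|q| <= 2 * (t - s) * Lam by rewrite ler_pM.
    by move: zq; arc_lra.
  have zX : `|z| <= X'.
    have := ler_normD (z - y) y; rewrite subrK.
    have : (2 * Lam + 1) * (t - s) <= (2 * Lam + 1) * T.
      rewrite ler_wpM2l ?addr_ge0 ?mulr_ge0//.
      by move: s0 tt2 t2T; arc_lra.
    by move: zy yX; rewrite /X'; arc_lra.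
  have l1 := LL _ _ _ zX (le_trans yX XX') qL.
  have l2 := legendre_ge (hC1 j) al_sl (hb j) z q p.
  have rT : 0 <= r <= 2 * T by move: s0 sr rt' t'T; arc_lra.
  have sT : 0 <= s <= 2 * T by move: s0 st tt2 t2T T0; arc_lra.
  have l3 := cpL _ _ y z sT rT.
  rewrite distrC (ger0_norm rs0) [`|y - z|]distrC mulrDr in l3.
  have := ler_wpM2l Kb0 zy; have := ler_wpM2l CL0 zy.
  have : Kb * (r - s) <= Kb * (2 * (t - s)) by rewrite ler_wpM2l.
  have : 0 <= Ch * Lam * (t - s) by rewrite mulr_ge0// ltW.
  by rewrite /C /L -/h; move: l1 l2 l3; rewrite -/h; arc_lra.
have Llip y y' q : `|y| <= X -> `|y'| <= X -> `|q| <= Lam ->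
    L y q - L y' q <= C * `|y - y'|.
  move=> yX y'X qL; apply: le_trans (LL _ _ _ (le_trans yX XX') (le_trans y'X XX') qL) _.
  by rewrite ler_wpM2r// /C; move: CL0 CLL Kb0 KbL ChL; arc_lra.
have blip s y y' : t1 <= s -> s <= t2 -> cp s y - cp s y' <= C * `|y - y'|.
  move=> t1s st2; apply: le_trans (cpL _ _ _ _ (inT _ t1s st2) (inT _ t1s st2)) _.
  rewrite subrr normr0 add0r ler_wpM2r// /C.
  by move: CL0 CLL Kb0 KbL ChL; arc_lra.
have Lconv := legendre_uniformly_convex (hC1 j) al_sl (hb j) X Lam.
move=> e0; have [d d0 dP] :=
  calibrated_window C0 Lam0 cL cX cal dom Llip blip Lconv e0.
exists d => // a' b' aa' a'b' b'b b'a'd.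
have h1 : t1 <= T - b' by rewrite /t1 lerD2l lerN2.
have h2 : T - b' < T - a' by rewrite ltrD2l ltrN2.
have h3 : T - a' <= t2 by rewrite /t2 lerD2l lerN2.
have h4 : T - a' - (T - b') <= d by move: b'a'd; arc_lra.
have dQ := dP _ _ h1 h2 h3 h4.
(* Undoing the time reversal changes the sign of the slope. *)
exists (- ((T - a' - (T - b'))^-1 *: (c (T - a') - c (T - b')))).
move=> s t a's st tb'.
have := dQ (T - t) (T - s); rewrite /c !subKr.
have -> : T - s - (T - t) = t - s by ring.
by move=> main; rewrite -normrN opprD opprB opprK scalerN; apply: main;
  rewrite lerD2l lerN2.
Qed.

End calibrated_arc.

(** * Gluing the arcs along a path *)

Unset Implicit Arguments.
Set Strict Implicit.

Theorem theorem7p3 (R : realType) (N m : nat)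
    (H : 'I_m.+1 -> 'rV[R]_N.+1 -> 'rV[R]_N.+1 -> R) (B : 'M[R]_m.+1)
    (P : probability (cadlag R m) R)
    (u0 : 'rV[R]_N.+1 -> 'cV[R]_m.+1) (u : R -> 'rV[R]_N.+1 -> 'cV[R]_m.+1)
    (T : R) (x : 'rV[R]_N.+1) (i : 'I_m.+1)
    (eta : cadlag R m -> R -> 'rV[R]_N.+1) (Omega' : set (cadlag R m)) :
  hamiltonians H ->
  coupling_matrix B ->
  markov_chain B P ->
  (forall j, (0 < P (@start_at R m j))%E) ->
  [bounded u0 y | y in setT] ->
  [lipschitz u0 y | y in setT] ->
  viscosity_solution H B u ->
  (forall y, u 0 y = u0 y) ->
  (forall S, 0 < S -> [bounded u z.1 z.2 | z in @slab R N.+1 S]) ->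
  (forall S, 0 < S ->
    unif_continuous_on (@slab R N.+1 S) (fun z => u z.1 z.2)) ->
  (forall S, 0 < S -> [lipschitz u z.1 z.2 | z in @slab R N.+1 S]) ->
  0 < T ->
  admissible_curve T x eta ->
  (u T x i ord0)%:E = lax_oleinik H P u0 T i eta ->
  lax_oleinik H P u0 T i eta =
    ereal_inf [set lax_oleinik H P u0 T i xi | xi in admissible_curve T x] ->
  Omega' `<=` @start_at R m i ->
  (cond_start P i).-negligible (~` Omega') ->
  (forall (w : cadlag R m) (a b : R) (j : 'I_m.+1), Omega' w ->
    0 <= a -> a < b -> b <= T -> (forall s, a <= s < b -> w s = j) ->
    (u (T - a) (eta w a) j ord0 - u (T - b) (eta w b) j ord0)%:E =
    (\int[lebesgue_measure]_(s in `[a, b])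
      (lagrangianG H B u j (T - s) (eta w s) (- derive1 (eta w) s))%:E)%E) ->
  forall w : cadlag R m, Omega' w ->
  [/\ forall t, 0 < t < T -> ~ jump_time w t ->
        derivable (eta w) t 1 /\ {for t, continuous (derive1 (eta w))},
      forall t, 0 < t < T -> jump_time w t ->
        (exists l, is_right_deriv (eta w) t l /\
          derive1 (eta w) s @[s --> t^'+] --> l) /\
        (exists l, is_left_deriv (eta w) t l /\
          derive1 (eta w) s @[s --> t^'-] --> l) &
      (exists l, is_right_deriv (eta w) 0 l /\
        derive1 (eta w) s @[s --> 0^'+] --> l) /\
      (exists l, is_left_deriv (eta w) T l /\
        derive1 (eta w) s @[s --> T^'-] --> l)].
Proof.
move=> H_ham _ _ _ _ _ [u_sub _] _ u_bounded _ u_lip T0 [_ _ eta_ac _] _ _ _ _.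
move=> eta_cal w Ow.
have f_ac := seg_ac_coord (T := T) (f := eta w).
have {}f_ac k : seg_ac T (fun x => `|eta w x.2 ord0 k - eta w x.1 ord0 k|).
  apply: f_ac => e e0; have [d d0 dP] := eta_ac e e0; exists d => // n a b.
  exact: dP.
have arc a b j : 0 <= a -> a < b -> b <= T -> (forall s, a <= s < b -> w s = j) ->
    exists g : R -> 'rV[R]_N.+1, forall e, 0 < e -> exists2 d, 0 < d &
    forall s t, a <= s -> s <= b -> a <= t -> t <= b -> `|t - s| <= d ->
    `|eta w t - eta w s - (t - s) *: g s| <= e * `|t - s|.
  move=> a0 ab bT wj; apply: strict_derivative => // e e0.
  apply: (@calibrated_strict _ _ _ H B u T j (eta w) a b H_ham _ u_bounded u_lip) => //.
  move=> s t as_ st tb; apply: eta_cal => //; first exact: le_trans as_.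
    exact: le_trans tb bT.
  by move=> r /andP[sr rt]; apply: wj; rewrite (le_trans as_ sr) (lt_le_trans rt tb).
have right_side t : 0 <= t -> t < T -> exists l, is_right_deriv (eta w) t l /\
    derive1 (eta w) s @[s --> t^'+] --> l.
  move=> t0 tT; have [d /= d0 dw] := path_right_cont w t0.
  pose b := t + Num.min d (T - t) / 2.
  have r0 : 0 < Num.min d (T - t) by rewrite lt_min d0 subr_gt0.
  have [rd rT] : Num.min d (T - t) <= d /\ Num.min d (T - t) <= T - t.
    by rewrite !ge_min !lexx orbT.
  have tb : t < b by rewrite /b; lra.
  have [||g gP] := arc t b (w t) t0 tb.
  - by rewrite /b; lra.
  - move=> s /andP[]; rewrite le_eqVlt => /predU1P[-> //|ts sb].
    by apply: dw => //=; rewrite ltr0_norm ?subr_lt0//; move: sb; rewrite /b; lra.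
  by exists (g t); split; [exact: (uniform_right_deriv gP)|exact: (derive1_right_limit gP)].
have left_side t : 0 < t -> t <= T -> exists l, is_left_deriv (eta w) t l /\
    derive1 (eta w) s @[s --> t^'-] --> l.
  (* At a jump time [j] differs from [w t]; the arc is still calibrated up to [t], since constancy
     is only required on the half-open interval. *)
  move=> t0 tT; have [j [d /= d0 dw]] := path_left_lim w t0.
  pose a := t - Num.min d t / 2.
  have r0 : 0 < Num.min d t by rewrite lt_min d0.
  have [rd rt] : Num.min d t <= d /\ Num.min d t <= t.
    by rewrite !ge_min !lexx orbT.
  have at_ : a < t by rewrite /a; lra.
  have [||||g gP] := arc a t j.
  - by rewrite /a; lra.
  - by [].
  - by [].
  - move=> s /andP[as_ st].
    by apply: dw => //=; rewrite gtr0_norm ?subr_gt0//; move: as_; rewrite /a; lra.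
  by exists (g t); split; [exact: (uniform_left_deriv gP)|exact: (derive1_left_limit gP)].
split.
(* Away from jumps the state is constant on both sides of [t], so [t] is interior to a single
   arc. *)
- move=> t /andP[t0 tT] /contrapT[d /= d0 dw].
  pose r := Num.min d (Num.min t (T - t)) / 2.
  have r0 : 0 < r by rewrite divr_gt0// !lt_min d0 t0 subr_gt0.
  have [rd rt rT] : [/\ 2 * r <= d, 2 * r <= t & 2 * r <= T - t].
    by rewrite /r mulrCA divff ?mulr1 ?pnatr_eq0// !ge_min !lexx !orbT.
  have [||||g gP] := arc (t - r) (t + r) (w t).
  - by lra.
  - by lra.
  - by lra.
  - move=> s /andP[s1 s2]; apply: dw => /=; rewrite ltr_norml; lra.
  have tr : t - r < t by lra.
  have tr' : t < t + r by lra.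
  split; last exact: (derive1_continuous gP).
  by have [] := uniform_derive gP tr tr'.
- by move=> t /andP[t0 tT] _; split; [apply: right_side => //; exact: ltW|
    apply: left_side => //; exact: ltW].
- by split; [exact: right_side|exact: left_side].
Qed.
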